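(* Let $V=L_{-4/3}(\mathfrak{sl}_2)$ be the simple affine vertex operator algebra associated with $\mathfrak{sl}_2=\mathfrak{sl}_2(\mathbb{C})$ at level $k=-4/3$. Then every first-order deformation $Y_1:V\otimes V\to V((x))$ of $V$ is trivial.
   Context: Affine vertex algebras. Let $\mathfrak{g}=\mathfrak{sl}_2(\mathbb{C})$ and let $\langle a,b\rangle=\mathrm{tr}(ab)$ be its normalized invariant bilinear form. $V^k(\mathfrak{g})$ is the universal affine vertex operator algebra of level $k$: it is generated by the fields $Y(a(-1)\mathbf{1},x)=\sum_{n\in\mathbb{Z}}a(n)x^{-n-1}$, $a\in\mathfrak{g}$, with $[a(m),b(n)]=[a,b](m+n)+m\,\delta_{m+n,0}\langle a,b\rangle k$ and $a(n)\mathbf{1}=0$ for $n\ge 0$, and is linearly spanned by the vectors $a_1(-n_1)\cdots a_r(-n_r)\mathbf{1}$ with $n_i\ge 1$, such a vector having conformal weight $n_1+\cdots+n_r$. $L_k(\mathfrak{g})$ is the simple quotient of $V^k(\mathfrak{g})$ (by the maximal proper graded ideal), with vertex operator $Y$ and vacuum $\mathbf{1}$. Notation. For a vertex algebra $(V,Y,\mathbf{1})$, write $Y(u,x)v=\sum_{n\in\mathbb{Z}}u_n v\,x^{-n-1}$, let $\mathrm{wt}$ denote conformal weight, and let $D:V\to V$, $Dv=v_{-2}\mathbf{1}$ (that is, $D=L(-1)$). $\delta(x)=\sum_{n\in\mathbb{Z}}x^n$, and binomial expressions such as $(x_1-x_2)^n$ are expanded in nonnegative integer powers of the second variable. First-order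 deformation. A first-order deformation of $V$ is a linear map $Y_1:V\otimes V\to V((x))$, $Y_1(u,x)v=\sum_{n\in\mathbb{Z}}u_n^{def}v\,x^{-n-1}$, such that $\mathbb{C}[t]/(t^2)\otimes_{\mathbb{C}}V$ with vertex operator $Y+tY_1$ (extended $\mathbb{C}[t]/(t^2)$-bilinearly) and vacuum $\mathbf{1}$ is a grading-restricted vertex algebra over $\mathbb{C}[t]/(t^2)$. Equivalently: (1) $\mathrm{wt}(u_n^{def}v)=\mathrm{wt}\,u-n-1+\mathrm{wt}\,v$ for homogeneous $u,v\in V$ and $n\in\mathbb{Z}$; (2) $Y_1(\mathbf{1},x)v=0$ and $Y_1(v,x)\mathbf{1}=0$ for all $v\in V$; (3) $[D,Y_1(u,x)]v=Y_1(Du,x)v=\frac{d}{dx}Y_1(u,x)v$ for all $u,v\in V$; (4) for all $u,v\in V$, as operators on $V$, $$x_0^{-1}\delta\left(\tfrac{x_1-x_2}{x_0}\right)\bigl(Y_1(u,x_1)Y(v,x_2)+Y(u,x_1)Y_1(v,x_2)\bigr)-x_0^{-1}\delta\left(\tfrac{-x_2+x_1}{x_0}\right)\bigl(Y_1(v,x_2)Y(u,x_1)+Y(v,x_2)Y_1(u,x_1)\bigr)$$ $$=x_2^{-1}\delta\left(\tfrac{x_1-x_0}{x_2}\right)\bigl(Y_1(Y(u,x_0)v,x_2)+Y(Y_1(u,x_0)v,x_2)\bigr).$$ Trivial deformation. A first-order deformation $Y_1$ is trivial if there is a grading-preserving $\mathbb{C}$-linear map $\phi:V\to V$ with $\phi(\mathbf{1})=0$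 such that $Y_1(u,x)v=Y(\phi(u),x)v-\phi(Y(u,x)v)+Y(u,x)\phi(v)$ for all $u,v\in V$. *)

(* Defs.v *)
From HB Require Import structures.
From mathcomp Require Import all_boot all_order all_algebra.
From mathcomp Require Import classical_sets fsbigop reals complex.

Set Implicit Arguments.
Unset Strict Implicit.
Unset Printing Implicit Defensive.

Import Order.TTheory GRing.Theory Num.Theory.
Local Open Scope ring_scope.

(* z (z - 1) ... (z - i + 1) / i`! for an arbitrary integer z *)
Definition gbinom (K : numFieldType) (z : int) (i : nat) : K :=
  (\prod_(j < i) (z%:~R - j%:R)) / i`!%:R.

(* A doubly infinite formal series F(x, y) = \sum_(p, q) F_{p,q} x^(-p-1) y^(-q-1)
   is represented by the function p, q |-> F_{p,q}.  Each of the three functions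
   below returns the coefficient of x0^(-l-1) x1^(-m-1) x2^(-n-1) in the product
   of a delta function with such a series.  The sums over i \in setT are the
   finite-support sums of fsbigop; in all uses below lower truncation makes
   the supports finite. *)
Section FormalDelta.
Variables (K : numFieldType) (V : lmodType K).
Implicit Type F : int -> int -> V.

(* x0^-1 delta((x1 - x2)/x0) F(x1, x2)
   = \sum_l x0^(-l-1) (x1 - x2)^l F(x1, x2) *)
Definition delta_x1_sub_x2 F (l m n : int) : V :=
  \sum_(i \in [set: nat])
    ((-1) ^+ i * gbinom K l i) *: F (l + m - i%:Z) (n + i%:Z).

(* x0^-1 delta((- x2 + x1)/x0) F(x1, x2)
   = \sum_l x0^(-l-1) (- x2 + x1)^l F(x1, x2) *)
Definition delta_neg_x2_add_x1 F (l m n : int) : V :=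
  \sum_(i \in [set: nat])
    ((-1) ^ (l - i%:Z) * gbinom K l i) *: F (m + i%:Z) (l + n - i%:Z).

(* x2^-1 delta((x1 - x0)/x2) F(x0, x2)
   = \sum_p x2^(-p-1) (x1 - x0)^p F(x0, x2);
   the power x1^(-m-1) forces p = i - m - 1, and (-1)^i C(i-m-1, i) = C(m, i) *)
Definition delta_x1_sub_x0 F (l m n : int) : V :=
  \sum_(i \in [set: nat])
    gbinom K m i *: F (l + i%:Z) (m + n - i%:Z).

Definition formal_jacobi F12 F21 F02 : Prop := forall l m n : int,
  delta_x1_sub_x2 F12 l m n - delta_neg_x2_add_x1 F21 l m n
  = delta_x1_sub_x0 F02 l m n.

End FormalDelta.

(* [homog n v]: v lies in the weight-n subspace;  [mode u n v] is u_n v *)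
Record vertexAlgebraData (K : numFieldType) := VertexAlgebraData {
  carrier :> lmodType K;
  homog : int -> carrier -> Prop;
  vac : carrier;
  mode : carrier -> int -> carrier -> carrier
}.

Arguments vac {K} _.
Arguments homog {K _} n v.
Arguments mode {K _} u n v.

Definition Dop (K : numFieldType) (V : vertexAlgebraData K) (v : V) : V :=
  mode v (-2) (vac V).

(* V is the direct sum of its weight subspaces, which are finite dimensional
   and vanish in sufficiently negative weights *)
Record restricted_grading (K : numFieldType) (V : vertexAlgebraData K) : Prop := {
  grading_lin : forall (n : int) (a : K) (u v : V),
    homog n u -> homog n v -> homog n (a *: u + v);
  grading_zero : forall n : int, homog n (0 : V);
  grading_span : forall v : V, exists (s : seq int) (f : int -> V),
    [/\ uniq s, (forall n, homog n (f n)) & v = \sum_(n <- s) f n];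
  grading_free : forall (s : seq int) (f : int -> V),
    uniq s -> (forall n, homog n (f n)) -> \sum_(n <- s) f n = 0 ->
    forall n, n \in s -> f n = 0;
  grading_fin : forall n : int, exists (d : nat) (b : 'I_d -> V),
    forall v, homog n v -> exists c : 'I_d -> K, v = \sum_(i < d) c i *: b i;
  grading_low : exists N : int, forall (n : int) (v : V),
    n < N -> homog n v -> v = 0
}.

Record vertex_algebra_axioms (K : numFieldType) (V : vertexAlgebraData K) : Prop := {
  va_grading : restricted_grading V;
  va_linear_r : forall (u : V) (n : int), linear (mode u n);
  va_linear_l : forall (n : int) (v : V), linear (fun u : V => mode u n v);
  va_trunc : forall u v : V, exists N : int, forall n, N <= n -> mode u n v = 0;
  va_vac_wt : homog 0 (vac V);
  va_mode_wt : forall (p q n : int) (u v : V),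
    homog p u -> homog q v -> homog (p - n - 1 + q) (mode u n v);
  va_vacuum : forall (n : int) (v : V),
    mode (vac V) n v = if n == -1 then v else 0;
  va_creation0 : forall u : V, mode u (-1) (vac V) = u;
  va_creation : forall (u : V) (n : int), 0 <= n -> mode u n (vac V) = 0;
  va_D_comm : forall (u v : V) (n : int),
    Dop (mode u n v) - mode u n (Dop v) = mode (Dop u) n v;
  va_D_deriv : forall (u v : V) (n : int),
    mode (Dop u) n v = - (n%:~R *: mode u (n - 1) v);
  va_jacobi : forall u v w : V,
    formal_jacobi (fun p q => mode u p (mode v q w))
                  (fun p q => mode v q (mode u p w))
                  (fun p q => mode (mode u p v) q w)
}.

Record vertexAlgebra (K : numFieldType) := VertexAlgebra {
  va_data :> vertexAlgebraData K;
  va_axioms : vertex_algebra_axioms va_data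
}.

Section Ideals.
Variables (K : numFieldType) (V : vertexAlgebra K).

Record graded_ideal (J : V -> Prop) : Prop := {
  ideal_zero : J 0;
  ideal_lin : forall (a : K) (u v : V), J u -> J v -> J (a *: u + v);
  ideal_mode_l : forall (u v : V) (n : int), J u -> J (mode u n v);
  ideal_mode_r : forall (u v : V) (n : int), J v -> J (mode u n v);
  ideal_graded : forall (s : seq int) (f : int -> V),
    uniq s -> (forall n, homog n (f n)) -> J (\sum_(n <- s) f n) ->
    forall n, n \in s -> J (f n)
}.

Definition proper_ideal (J : V -> Prop) : Prop := exists v : V, ~ J v.

Definition maximal_proper_graded_ideal (J : V -> Prop) : Prop :=
  [/\ graded_ideal J, proper_ideal J &
      forall J' : V -> Prop, graded_ideal J' -> proper_ideal J' ->
        forall v, J' v -> J v].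

End Ideals.

Record va_morphism (K : numFieldType) (U V : vertexAlgebra K)
    (f : {linear U -> V}) : Prop := {
  va_morph_vac : f (vac U) = vac V;
  va_morph_mode : forall (u v : U) (n : int), f (mode u n v) = mode (f u) n (f v);
  va_morph_wt : forall (n : int) (u : U), homog n u -> homog n (f u)
}.

(* V, with the projection pi, is the simple quotient of U *)
Definition simple_quotient (K : numFieldType) (U V : vertexAlgebra K)
    (pi : {linear U -> V}) : Prop :=
  [/\ va_morphism pi, (forall v : V, exists u : U, pi u = v) &
      maximal_proper_graded_ideal (fun u : U => pi u = 0)].

Section Sl2.
Variable K : numFieldType.

Definition traceless : {pred 'M[K]_2} := [pred a | \tr a == 0].

Lemma traceless_submod_closed : submod_closed traceless.
Proof.
split=> [|c a b]; rewrite !inE ?mxtrace0 // => /eqP ta /eqP tb.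
by rewrite mxtraceD mxtraceZ ta tb mulr0 addr0.
Qed.

HB.instance Definition _ :=
  GRing.isSubmodClosed.Build K 'M[K]_2 traceless traceless_submod_closed.

Record sl2 := Sl2 { sl2_mx :> 'M[K]_2; sl2P : sl2_mx \in traceless }.

HB.instance Definition _ := [isSub for sl2_mx].
HB.instance Definition _ := [Choice of sl2 by <:].
HB.instance Definition _ := [SubChoice_isSubLmodule of sl2 by <:].

Fact bracket_subproof (a b : sl2) :
  (a : 'M[K]_2) *m b - (b : 'M[K]_2) *m a \in traceless.
Proof. by rewrite inE linearB /= [X in _ - X]mxtrace_mulC subrr. Qed.

Definition bracket (a b : sl2) : sl2 := Sl2 (bracket_subproof a b).

Definition trace_form (a b : sl2) : K := \tr ((a : 'M[K]_2) *m b).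

(* [act a n w] is a(n) w: a module over the affinization of sl2 on which the
   canonical central element acts as the scalar k *)
Record affine_module (k : K) (M : lmodType K) (act : sl2 -> int -> M -> M) : Prop := {
  act_linear_r : forall (a : sl2) (n : int), linear (act a n);
  act_linear_l : forall (n : int) (w : M), linear (fun a : sl2 => act a n w);
  act_comm : forall (a b : sl2) (m n : int) (w : M),
    act a m (act b n w) - act b n (act a m w) =
    act (bracket a b) (m + n) w
    + (if m + n == 0 then m%:~R * trace_form a b * k else 0) *: w
}.

Section Universal.
Variables (k : K) (V : vertexAlgebra K) (iota : {linear sl2 -> V}).

Definition affine_mode (a : sl2) (n : int) (v : V) : V := mode (iota a) n v.

(* a_1(-n_1) ... a_r(-n_r) 1, the list holding the pairs (a_i, n_i - 1) *)
Definition affine_word (s : seq (sl2 * nat)) : V :=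
  foldr (fun x v => affine_mode x.1 (- (x.2.+1)%:Z) v) (vac V) s.

(* V is V^k(sl2), with iota a = a(-1) 1.  The last field says that V, as a
   module over the affinization, is induced from the one-dimensional module of
   level k over sl2[t] + K: it is universal among the modules of level k with a
   vector annihilated by all a(n), n >= 0. *)
Record universal_affine : Prop := {
  ua_module : affine_module k affine_mode;
  ua_vac : forall (a : sl2) (n : int), 0 <= n -> affine_mode a n (vac V) = 0;
  ua_span : forall v : V, exists s : seq (K * seq (sl2 * nat)),
    v = \sum_(x <- s) x.1 *: affine_word x.2;
  ua_weight : forall s : seq (sl2 * nat),
    homog (\sum_(x <- s) x.2.+1)%N%:Z (affine_word s);
  ua_universal : forall (M : lmodType K) (act : sl2 -> int -> M -> M) (w : M),
    affine_module k act -> (forall a n, 0 <= n -> act a n w = 0) ->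
    exists f : {linear V -> M},
      f (vac V) = w /\ forall a n v, f (affine_mode a n v) = act a n (f v)
}.

End Universal.

(* V is (isomorphic to) L_k(sl2) *)
Definition is_simple_affine_sl2 (k : K) (V : vertexAlgebra K) : Prop :=
  exists (U : vertexAlgebra K) (iota : {linear sl2 -> U}) (pi : {linear U -> V}),
    universal_affine k iota /\ simple_quotient pi.

End Sl2.

Section Deformations.
Variables (K : numFieldType) (V : vertexAlgebra K).

(* [Y1 u n v] is u_n^def v *)
Record first_order_deformation (Y1 : V -> int -> V -> V) : Prop := {
  def_linear_r : forall (u : V) (n : int), linear (Y1 u n);
  def_linear_l : forall (n : int) (v : V), linear (fun u : V => Y1 u n v);
  def_trunc : forall u v : V, exists N : int, forall n, N <= n -> Y1 u n v = 0;
  def_wt : forall (p q n : int) (u v : V),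
    homog p u -> homog q v -> homog (p - n - 1 + q) (Y1 u n v);
  def_vac_l : forall (n : int) (v : V), Y1 (vac V) n v = 0;
  def_vac_r : forall (n : int) (v : V), Y1 v n (vac V) = 0;
  def_D_comm : forall (u v : V) (n : int),
    Dop (Y1 u n v) - Y1 u n (Dop v) = Y1 (Dop u) n v;
  def_D_deriv : forall (u v : V) (n : int),
    Y1 (Dop u) n v = - (n%:~R *: Y1 u (n - 1) v);
  def_jacobi : forall u v w : V,
    formal_jacobi
      (fun p q => Y1 u p (mode v q w) + mode u p (Y1 v q w))
      (fun p q => Y1 v q (mode u p w) + mode v q (Y1 u p w))
      (fun p q => Y1 (mode u p v) q w + mode (Y1 u p v) q w)
}.

Definition trivial_deformation (Y1 : V -> int -> V -> V) : Prop :=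
  exists phi : {linear V -> V},
    [/\ (forall (n : int) (v : V), homog n v -> homog n (phi v)),
        phi (vac V) = 0 &
        forall (u v : V) (n : int),
          Y1 u n v = mode (phi u) n v - phi (mode u n v) + mode u n (phi v)].

End Deformations.

(* Main.v *)
(* Over the dual numbers, V[t]/(t^2) with Y + t Y_1 is a vertex algebra generated by
   lifts of V_1 = sl2.  Since H^2(sl2, sl2) = 0 the lifts can be corrected to first
   order so that they satisfy the affine relations at a level k + t k'.  At
   k = -4/3 the universal algebra has a singular vector P 1 of weight 3, which is 0
   in V, so the deformed P 1 lies in t V.  If P' is the image of P under the
   contravariant anti-involution, then P' annihilates V_3, whereas P' P 1 = p(c) 1
   for a polynomial p in the central element c with a simple zero at c = -4/3;
   hence k' = 0.  By universality there is then an affine module map f from V^k to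
   V[t]/(t^2) lifting the projection onto V.  It maps the maximal ideal to a
   submodule of t V without vectors of weight 0, that is, to 0 because V is simple.
   So f factors through a section V -> V[t]/(t^2), v |-> v - t phi(v), which is a
   morphism of vertex algebras, and phi trivializes Y_1. *)
From HB Require Import structures.
Require Import Defs.
From mathcomp Require Import all_boot all_order all_algebra.
From mathcomp Require Import boolp classical_sets fsbigop reals complex.
From mathcomp Require Import ring lra zify ssrZ.

Set Implicit Arguments.
Unset Strict Implicit.
Unset Printing Implicit Defensive.

Import Order.TTheory GRing.Theory Num.Theory.
Local Open Scope ring_scope.

(** * Finite-support sums and the formal Jacobi identity *)

(** The universal property of V^k only yields maps into affine modules on which the central element
    acts by the scalar k. The first-order change k' of the level must therefore be excluded before
    anything can be lifted. The vector P 1 alone does not reveal k', since after deformation it may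
    be any vector of t V_3. Applying P' removes this freedom: t V is a copy of the undeformed V, so
    P' kills its part of weight 3, while P' P 1 lies in weight 0, where it is a number times the
    vacuum. For this reason the central element is kept as an indeterminate in the computations. It
    acts by k on V but by k + t k' on V[t]/(t^2), and the t-coefficient of p(k + t k') is p'(k) k';
    a simple zero of p at k thus forces k' = 0. The lift respects only the modes of sl2.
    Associativity extends this to the modes of all words. *)

Section LinearMaps.
Variables (K : numFieldType) (U V : lmodType K) (f : U -> V).
Hypothesis lf : linear f.

Let g : {linear U -> V} := HB.pack f (GRing.isLinear.Build K U V *:%R f lf).

Lemma lin0 : f 0 = 0. Proof. exact: (linear0 g). Qed.
Lemma linD u v : f (u + v) = f u + f v. Proof. exact: (linearD g). Qed.
Lemma linB u v : f (u - v) = f u - f v. Proof. exact: (linearB g). Qed.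
Lemma linN u : f (- u) = - f u. Proof. exact: (linearN g). Qed.
Lemma linZ a u : f (a *: u) = a *: f u.
Proof. by have := lf a u 0; rewrite lin0 !addr0. Qed.
Lemma lin_sum I (r : seq I) (P : pred I) (F : I -> U) :
  f (\sum_(i <- r | P i) F i) = \sum_(i <- r | P i) f (F i).
Proof. exact: (linear_sum g). Qed.

End LinearMaps.

Section FiniteSupportSums.
Variables (K : numFieldType).

Definition truncated (V : lmodType K) (F : nat -> V) : Prop :=
  exists N : nat, forall i, (N <= i)%N -> F i = 0.

Lemma fsbig_nat_trunc (V : lmodType K) (F : nat -> V) (N : nat) :
  (forall i, (N <= i)%N -> F i = 0) ->
  \sum_(i \in [set: nat]) F i = \sum_(i < N) F i.
Proof.
move=> FN; rewrite (fsbigE (iota 0 N)) ?iota_uniq //.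
- rewrite -(big_mkord xpredT F) /index_iota subn0.
  by apply: eq_bigl => i; rewrite in_setT.
- move=> i _; rewrite mem_iota add0n /=.
  by case: ltnP => // /FN.
Qed.

(** A sum of infinite support is 0 by convention and [P] contains 0, so every [F] is covered. *)
Lemma fsbig_nat_closed (V : lmodType K) (P : V -> Prop) (F : nat -> V) :
  P 0 -> (forall u v, P u -> P v -> P (u + v)) -> (forall i, P (F i)) ->
  P (\sum_(i \in [set: nat]) F i).
Proof. by move=> P0 PD PF; apply: (big_ind P). Qed.

Lemma truncatedD (V : lmodType K) (F G : nat -> V) :
  truncated F -> truncated G -> truncated (fun i => F i + G i).
Proof.
move=> [M FM] [N GN]; exists (maxn M N) => i; rewrite geq_max => /andP[Mi Ni].
by rewrite FM ?GN ?addr0.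
Qed.

Lemma truncatedZ (V : lmodType K) (a : nat -> K) (F : nat -> V) :
  truncated F -> truncated (fun i => a i *: F i).
Proof. by move=> [N FN]; exists N => i /FN ->; rewrite scaler0. Qed.

Lemma fsbig_natD (V : lmodType K) (F G : nat -> V) :
  truncated F -> truncated G ->
  \sum_(i \in [set: nat]) (F i + G i) =
  \sum_(i \in [set: nat]) F i + \sum_(i \in [set: nat]) G i.
Proof.
move=> [M FM] [N GN].
have FP i : (maxn M N <= i)%N -> F i = 0 by rewrite geq_max => /andP[/FM].
have GP i : (maxn M N <= i)%N -> G i = 0 by rewrite geq_max => /andP[_ /GN].
rewrite (fsbig_nat_trunc FP) (fsbig_nat_trunc GP) -big_split.
by apply: fsbig_nat_trunc => i le_i; rewrite FP // GP // addr0.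
Qed.

Lemma fsbig_nat_lin (U V : lmodType K) (f : U -> V) (F : nat -> U) :
  linear f -> truncated F ->
  f (\sum_(i \in [set: nat]) F i) = \sum_(i \in [set: nat]) f (F i).
Proof.
move=> lf [N FN]; rewrite (fsbig_nat_trunc FN) (lin_sum lf).
by apply/esym/fsbig_nat_trunc => i /FN ->; rewrite (lin0 lf).
Qed.

Lemma eq_fsbig_nat (V : lmodType K) (F G : nat -> V) : F =1 G ->
  \sum_(i \in [set: nat]) F i = \sum_(i \in [set: nat]) G i.
Proof. by move=> FG; apply: eq_fsbigr => i _. Qed.

End FiniteSupportSums.

Section JacobiSums.
Variables (K : numFieldType).
Implicit Types U V : lmodType K.

(** The direction in which [delta_x1_sub_x2] sums; the other two delta functions sum in the
    direction of [trunc_down]. Additivity of the sums rests on truncation, because infinite support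
    makes a sum 0. *)
Definition trunc_up V (F : int -> int -> V) : Prop :=
  forall a b : int, truncated (fun i : nat => F (a - i%:Z) (b + i%:Z)).

Definition trunc_down V (F : int -> int -> V) : Prop :=
  forall a b : int, truncated (fun i : nat => F (a + i%:Z) (b - i%:Z)).

Lemma formal_jacobiD V (F12 F21 F02 G12 G21 G02 : int -> int -> V) :
  trunc_up F12 -> trunc_down F21 -> trunc_down F02 ->
  trunc_up G12 -> trunc_down G21 -> trunc_down G02 ->
  formal_jacobi F12 F21 F02 -> formal_jacobi G12 G21 G02 ->
  formal_jacobi (fun p q => F12 p q + G12 p q) (fun p q => F21 p q + G21 p q)
    (fun p q => F02 p q + G02 p q).
Proof.
move=> tF1 tF2 tF3 tG1 tG2 tG3 jF jG l m n.
have := congr2 +%R (jF l m n) (jG l m n).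
rewrite /delta_x1_sub_x2 /delta_neg_x2_add_x1 /delta_x1_sub_x0 => E.
under eq_fsbig_nat => i do rewrite scalerDr.
under [X in _ - X]eq_fsbig_nat => i do rewrite scalerDr.
under [X in _ = X]eq_fsbig_nat => i do rewrite scalerDr.
rewrite (fsbig_natD (truncatedZ _ (tF1 _ _)) (truncatedZ _ (tG1 _ _))).
rewrite (fsbig_natD (truncatedZ _ (tF2 _ _)) (truncatedZ _ (tG2 _ _))).
rewrite (fsbig_natD (truncatedZ _ (tF3 _ _)) (truncatedZ _ (tG3 _ _))).
by rewrite -E opprD addrACA.
Qed.

Lemma formal_jacobi_lin U V (f : U -> V) (F12 F21 F02 : int -> int -> U) :
  linear f ->
  trunc_up F12 -> trunc_down F21 -> trunc_down F02 ->
  formal_jacobi F12 F21 F02 ->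
  formal_jacobi (fun p q => f (F12 p q)) (fun p q => f (F21 p q))
    (fun p q => f (F02 p q)).
Proof.
move=> lf tF1 tF2 tF3 jF l m n.
have := congr1 f (jF l m n); rewrite (linB lf).
rewrite /delta_x1_sub_x2 /delta_neg_x2_add_x1 /delta_x1_sub_x0.
rewrite (fsbig_nat_lin lf (truncatedZ _ (tF1 _ _))).
rewrite (fsbig_nat_lin lf (truncatedZ _ (tF2 _ _))).
rewrite (fsbig_nat_lin lf (truncatedZ _ (tF3 _ _))).
under eq_fsbig_nat => i do rewrite (linZ lf).
under [X in _ - X]eq_fsbig_nat => i do rewrite (linZ lf).
by under [X in _ = X -> _]eq_fsbig_nat => i do rewrite (linZ lf).
Qed.

Lemma eq_formal_jacobi V (F12 F21 F02 G12 G21 G02 : int -> int -> V) :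
  F12 =2 G12 -> F21 =2 G21 -> F02 =2 G02 ->
  formal_jacobi F12 F21 F02 -> formal_jacobi G12 G21 G02.
Proof.
move=> e1 e2 e3 jF l m n; have := jF l m n.
rewrite /delta_x1_sub_x2 /delta_neg_x2_add_x1 /delta_x1_sub_x0.
under eq_fsbig_nat => i do rewrite e1.
under [X in _ - X]eq_fsbig_nat => i do rewrite e2.
by under [X in _ = X -> _]eq_fsbig_nat => i do rewrite e3.
Qed.

Lemma trunc_upD V (F G : int -> int -> V) :
  trunc_up F -> trunc_up G -> trunc_up (fun p q => F p q + G p q).
Proof. by move=> tF tG a b; apply: truncatedD. Qed.

Lemma trunc_downD V (F G : int -> int -> V) :
  trunc_down F -> trunc_down G -> trunc_down (fun p q => F p q + G p q).
Proof. by move=> tF tG a b; apply: truncatedD. Qed.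

Definition vanishes_above V (h : int -> V) : Prop :=
  exists N : int, forall n, N <= n -> h n = 0.

Lemma trunc_up_comp U V (f : int -> U -> V) (h : int -> U) :
  (forall p, f p 0 = 0) -> vanishes_above h -> trunc_up (fun p q => f p (h q)).
Proof.
move=> f0 [N hN] a b; exists `|N - b|%N => i le_i.
by rewrite hN ?f0 //; lia.
Qed.

Lemma trunc_down_comp U V (f : int -> U -> V) (h : int -> U) :
  (forall p, f p 0 = 0) -> vanishes_above h -> trunc_down (fun p q => f q (h p)).
Proof.
move=> f0 [N hN] a b; exists `|N - a|%N => i le_i.
by rewrite hN ?f0 //; lia.
Qed.

Lemma trunc_up_map U V (f : U -> V) (F : int -> int -> U) :
  f 0 = 0 -> trunc_up F -> trunc_up (fun p q => f (F p q)).
Proof. by move=> f0 tF a b; case: (tF a b) => N FN; exists N => i /FN ->. Qed.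

Lemma trunc_down_map U V (f : U -> V) (F : int -> int -> U) :
  f 0 = 0 -> trunc_down F -> trunc_down (fun p q => f (F p q)).
Proof. by move=> f0 tF a b; case: (tF a b) => N FN; exists N => i /FN ->. Qed.

(** The support of a sum of pairs differs from the supports of its two components. Each component
    identity is therefore transported into [V * V] by a linear injection, and the two results are
    added. *)
Lemma formal_jacobi_pair V (F12 F21 F02 : int -> int -> V * V) :
  trunc_up F12 -> trunc_down F21 -> trunc_down F02 ->
  formal_jacobi (fun p q => (F12 p q).1) (fun p q => (F21 p q).1)
    (fun p q => (F02 p q).1) ->
  formal_jacobi (fun p q => (F12 p q).2) (fun p q => (F21 p q).2)
    (fun p q => (F02 p q).2) ->
  formal_jacobi F12 F21 F02.
Proof.
move=> t1 t2 t3 j1 j2.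
pose in1 (v : V) : V * V := (v, 0); pose in2 (v : V) : V * V := (0, v).
have l1 : linear in1 by move=> a u v; congr pair; rewrite /= scaler0 addr0.
have l2 : linear in2 by move=> a u v; congr pair; rewrite /= scaler0 addr0.
pose p1 (w : V * V) := w.1; pose p2 (w : V * V) := w.2.
have {}j1 := formal_jacobi_lin l1 (trunc_up_map (f := p1) erefl t1)
  (trunc_down_map (f := p1) erefl t2) (trunc_down_map (f := p1) erefl t3) j1.
have {}j2 := formal_jacobi_lin l2 (trunc_up_map (f := p2) erefl t1)
  (trunc_down_map (f := p2) erefl t2) (trunc_down_map (f := p2) erefl t3) j2.
pose q1 (w : V * V) := in1 w.1; pose q2 (w : V * V) := in2 w.2.
have jD := formal_jacobiD (trunc_up_map (f := q1) erefl t1)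
  (trunc_down_map (f := q1) erefl t2) (trunc_down_map (f := q1) erefl t3)
  (trunc_up_map (f := q2) erefl t1)
  (trunc_down_map (f := q2) erefl t2) (trunc_down_map (f := q2) erefl t3) j1 j2.
have pE w : q1 w + q2 w = w.
  by case: w => x y; congr pair; rewrite /= (addr0, add0r).
by apply: (eq_formal_jacobi _ _ _ jD) => p q; apply: pE.
Qed.

End JacobiSums.

(** * Mode identities and the dual-number vertex algebra *)

Section GeneralizedBinomials.
Variable K : numFieldType.

Lemma gbinom_n0 (z : int) : gbinom K z 0 = 1.
Proof. by rewrite /gbinom big_ord0 fact0 divr1. Qed.

Lemma gbinom_n1 (z : int) : gbinom K z 1 = z%:~R.
Proof. by rewrite /gbinom big_ord_recl big_ord0 mulr1 subr0 divr1. Qed.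

Lemma gbinom_0S (i : nat) : gbinom K 0 i.+1 = 0.
Proof. by rewrite /gbinom big_ord_recl subrr !mul0r. Qed.

End GeneralizedBinomials.

Lemma sum_extend (V : nmodType) (s t : seq int) (f : int -> V) :
  uniq s -> uniq t -> {subset s <= t} ->
  \sum_(n <- s) f n = \sum_(n <- t) if n \in s then f n else 0.
Proof.
move=> us ut st; rewrite -big_mkcond /= -[RHS]big_filter; apply: perm_big.
apply: uniq_perm; rewrite ?filter_uniq // => n; rewrite mem_filter.
by case: (boolP (n \in s)) => // /st ->.
Qed.

Section ModeIdentities.
Variables (K : numFieldType) (V : vertexAlgebra K).
Implicit Types u v w : V.

Let va := va_axioms V.

Lemma mode_lin_r u n : linear (mode u n).
Proof. exact: (va_linear_r va). Qed.
Lemma mode_lin_l n v : linear (fun u : V => mode u n v).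
Proof. exact: (va_linear_l va). Qed.

Lemma mode0r u n : mode u n 0 = 0. Proof. exact: lin0 (mode_lin_r u n). Qed.
Lemma mode0l n v : mode (0 : V) n v = 0. Proof. exact: lin0 (mode_lin_l n v). Qed.
Lemma modeDr u n v w : mode u n (v + w) = mode u n v + mode u n w.
Proof. exact: linD (mode_lin_r u n) _ _. Qed.
Lemma modeDl u v n w : mode (u + v) n w = mode u n w + mode v n w.
Proof. exact: linD (mode_lin_l n w) _ _. Qed.
Lemma modeNr u n v : mode u n (- v) = - mode u n v.
Proof. exact: linN (mode_lin_r u n) _. Qed.
Lemma modeNl u n v : mode (- u) n v = - mode u n v.
Proof. exact: linN (mode_lin_l n v) _. Qed.
Lemma modeZr a u n v : mode u n (a *: v) = a *: mode u n v.
Proof. exact: linZ (mode_lin_r u n) _ _. Qed.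
Lemma modeZl a u n v : mode (a *: u) n v = a *: mode u n v.
Proof. exact: linZ (mode_lin_l n v) _ _. Qed.

(** The case l = 0 of the Jacobi identity: both sums on the left reduce to their first term. *)
Lemma commutator_formula u v (N : nat) :
  (forall i : nat, (N <= i)%N -> mode u i%:Z v = 0) ->
  forall (m n : int) w,
  mode u m (mode v n w) - mode v n (mode u m w) =
  \sum_(i < N) gbinom K m i *: mode (mode u i%:Z v) (m + n - i%:Z) w.
Proof.
move=> uv0 m n w; have := va_jacobi va u v w 0 m n.
rewrite /delta_x1_sub_x2 /delta_neg_x2_add_x1 /delta_x1_sub_x0.
rewrite (@fsbig_nat_trunc _ _ _ 1); last first.
  by case=> // i _; rewrite gbinom_0S mulr0 scale0r.
rewrite (@fsbig_nat_trunc _ _ _ 1); last first.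
  by case=> // i _; rewrite gbinom_0S mulr0 scale0r.
rewrite (@fsbig_nat_trunc _ _ _ N); last first.
  by move=> i /uv0; rewrite add0r => ->; rewrite mode0l scaler0.
rewrite !big_ord1 /= gbinom_n0 expr0 subr0 expr0z mulr1 !scale1r !(add0r, addr0).
move=> ->.
by apply: eq_bigr => i _; rewrite add0r.
Qed.

(** The case m = 0 of the Jacobi identity: the sum on the right reduces to its first term. *)
Lemma associativity_formula u l v n w :
  mode (mode u l v) n w =
  \sum_(i \in [set: nat])
    ((-1) ^+ i * gbinom K l i) *: mode u (l - i%:Z) (mode v (n + i%:Z) w)
  - \sum_(i \in [set: nat])
    ((-1) ^ (l - i%:Z) * gbinom K l i) *: mode v (l + n - i%:Z) (mode u i%:Z w).
Proof.
have := va_jacobi va u v w l 0 n.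
rewrite /delta_x1_sub_x2 /delta_neg_x2_add_x1 /delta_x1_sub_x0.
rewrite [X in _ = X -> _](@fsbig_nat_trunc _ _ _ 1); last first.
  by case=> // i _; rewrite gbinom_0S scale0r.
by rewrite big_ord1 gbinom_n0 scale1r addr0 add0r subr0 => <-.
Qed.

(** The Jacobi identity on the vacuum with m = -1 and n = 0. Creation kills the first sum and leaves
    only u_(-1) 1 = u of the second. A vector w_(-1-i) 1 on the right is D^i w / i!. *)
Lemma skew_symmetry u l v :
  - ((-1) ^ l *: mode v l u) =
  \sum_(i \in [set: nat])
    gbinom K (-1) i *: mode (mode u (l + i%:Z) v) (-1 - i%:Z) (vac V).
Proof.
have := va_jacobi va u v (vac V) l (-1) 0.
rewrite /delta_x1_sub_x2 /delta_neg_x2_add_x1 /delta_x1_sub_x0.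
rewrite (@fsbig_nat_trunc _ _ (fun i => _ *: mode u _ _) 0); last first.
  by move=> i _; rewrite (va_creation va) ?mode0r ?scaler0 ?add0r.
rewrite (@fsbig_nat_trunc _ _ (fun i => _ *: mode v _ _) 1); last first.
  move=> i i1; rewrite (va_creation va u) ?mode0r ?scaler0 //; lia.
by rewrite big_ord0 big_ord1 /= gbinom_n0 mulr1 !addr0 (va_creation0 va) sub0r.
Qed.

End ModeIdentities.

Section DualNumbers.
Variables (K : numFieldType) (V : vertexAlgebra K) (Y1 : V -> int -> V -> V).
Hypothesis hY : first_order_deformation Y1.

Let va := va_axioms V.

Definition dual_homog (n : int) (v : V * V) : Prop := homog n v.1 /\ homog n v.2.

Definition dual_mode (u : V * V) (n : int) (v : V * V) : V * V :=
  (mode u.1 n v.1, mode u.1 n v.2 + mode u.2 n v.1 + Y1 u.1 n v.1).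

(* The pair (v0, v1) stands for v0 + t v1, so that this is V[t]/(t^2) with the
   vertex operator Y + t Y_1, regarded as a vertex algebra over K. *)
Definition dual_data : vertexAlgebraData K :=
  @VertexAlgebraData K (V * V)%type dual_homog (vac V, 0) dual_mode.

Lemma def0r u n : Y1 u n 0 = 0. Proof. exact: lin0 (def_linear_r hY u n). Qed.
Lemma def0l n v : Y1 0 n v = 0. Proof. exact: lin0 (def_linear_l hY n v). Qed.

Lemma dual_linear_r (u : dual_data) (n : int) : linear (mode u n).
Proof.
move=> a v w; rewrite /mode /= /dual_mode /=; congr pair.
  by rewrite /= modeDr modeZr.
rewrite /= !modeDr !modeZr (linD (def_linear_r hY u.1 n)).
rewrite (linZ (def_linear_r hY u.1 n)) !scalerDr.
by rewrite [X in X + (_ + _)]addrACA [LHS]addrACA.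
Qed.

Lemma dual_linear_l (n : int) (v : dual_data) :
  linear (fun u : dual_data => mode u n v).
Proof.
move=> a u w; rewrite /mode /= /dual_mode /=; congr pair.
  by rewrite /= modeDl modeZl.
rewrite /= !modeDl !modeZl (linD (def_linear_l hY n v.1)).
rewrite (linZ (def_linear_l hY n v.1)) !scalerDr.
by rewrite [X in X + (_ + _)]addrACA [LHS]addrACA.
Qed.

Lemma dual_trunc (u v : dual_data) : vanishes_above (fun n => mode u n v).
Proof.
have [N1 h1] := va_trunc va u.1 v.1.
have [N2 h2] := va_trunc va u.1 v.2.
have [N3 h3] := va_trunc va u.2 v.1.
have [N4 h4] := def_trunc hY u.1 v.1.
exists (`|N1|%:Z + `|N2|%:Z + `|N3|%:Z + `|N4|%:Z) => n le_n.
rewrite /mode /= /dual_mode /= h1 ?h2 ?h3 ?h4; try lia.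
by rewrite !addr0.
Qed.

Lemma dual_grading : restricted_grading dual_data.
Proof.
have gr := va_grading va.
split.
- by move=> n a u v [u1 u2] [v1 v2]; split; apply: (grading_lin gr).
- by move=> n; split; apply: (grading_zero gr).
- move=> [v1 v2].
  have [s1 [f1 [us1 h1 ->]]] := grading_span gr v1.
  have [s2 [f2 [us2 h2 ->]]] := grading_span gr v2.
  pose g (s : seq int) (f : int -> V) n := if n \in s then f n else 0.
  exists (undup (s1 ++ s2)), (fun n => (g s1 f1 n, g s2 f2 n)).
  split; first exact: undup_uniq.
  + by move=> n; split; rewrite /g /=; case: ifP => _ //; apply: (grading_zero gr).
  + rewrite (sum_extend f1 us1 (undup_uniq (s1 ++ s2))); last first.
      by move=> n ns; rewrite mem_undup mem_cat ns.
    rewrite (sum_extend f2 us2 (undup_uniq (s1 ++ s2))); last first.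
      by move=> n ns; rewrite mem_undup mem_cat ns orbT.
    rewrite [RHS]surjective_pairing.
    rewrite (big_morph (fun w : V * V => w.1) (fun _ _ => erefl) erefl).
    by rewrite (big_morph (fun w : V * V => w.2) (fun _ _ => erefl) erefl).
- move=> s f us hf f0 n ns.
  rewrite [LHS]surjective_pairing; congr pair.
  + apply: (grading_free gr (f := fun n => (f n).1) us) => // [m|].
      by case: (hf m).
    rewrite -[RHS](congr1 (fun w : V * V => w.1) f0).
    by rewrite (big_morph (fun w : V * V => w.1) (fun _ _ => erefl) erefl).
  + apply: (grading_free gr (f := fun n => (f n).2) us) => // [m|].
      by case: (hf m).
    rewrite -[RHS](congr1 (fun w : V * V => w.2) f0).
    by rewrite (big_morph (fun w : V * V => w.2) (fun _ _ => erefl) erefl).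
- move=> n; have [d [b hb]] := grading_fin gr n.
  exists (d + d)%N, (fun i => match split i with
    inl j => (b j, 0) | inr j => (0, b j) end) => -[v1 v2] [/= /hb[c1 ->] /hb[c2 ->]].
  exists (fun i => match split i with inl j => c1 j | inr j => c2 j end).
  have sl (i : 'I_d) : split (lshift d i) = inl i by exact: unsplitK (inl i).
  have sr (i : 'I_d) : split (rshift d i) = inr i by exact: unsplitK (inr i).
  rewrite big_split_ord /=.
  under [X in _ = X + _]eq_bigr => i _ do rewrite sl.
  under [X in _ = _ + X]eq_bigr => i _ do rewrite sr.
  rewrite [RHS]surjective_pairing /=.
  rewrite !(big_morph (fun w : V * V => w.1) (fun _ _ => erefl) erefl).
  rewrite !(big_morph (fun w : V * V => w.2) (fun _ _ => erefl) erefl) /=.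
  congr pair.
    by rewrite [X in _ + X]big1 ?addr0 // => i _; rewrite scaler0.
  by rewrite [X in X + _]big1 ?add0r // => i _; rewrite scaler0.
- have [N hN] := grading_low gr; exists N => n [v1 v2] ltn [h1 h2].
  by congr pair; apply: (hN n).
Qed.

Lemma dual_jacobi (u v w : dual_data) :
  formal_jacobi (fun p q => mode u p (mode v q w))
                (fun p q => mode v q (mode u p w))
                (fun p q => mode (mode u p v) q w).
Proof.
have m0r (x : dual_data) p : mode x p 0 = 0 := lin0 (dual_linear_r x p).
have m0l p (x : dual_data) : mode (0 : dual_data) p x = 0 := lin0 (dual_linear_l p x).
apply: formal_jacobi_pair.
- exact: (trunc_up_comp (m0r u) (dual_trunc v w)).
- exact: (trunc_down_comp (m0r v) (dual_trunc u w)).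
- exact: (trunc_down_comp (f := fun p (x : dual_data) => mode x p w)
    (fun p => m0l p w) (dual_trunc u v)).
- exact: (va_jacobi va).
have tu (x y z : V) : trunc_up (fun p q => mode x p (mode y q z)).
  exact: (trunc_up_comp (fun p => mode0r x p) (va_trunc va y z)).
have td (x y z : V) : trunc_down (fun p q => mode y q (mode x p z)).
  exact: (trunc_down_comp (fun p => mode0r y p) (va_trunc va x z)).
have td' (x y z : V) : trunc_down (fun p q => mode (mode x p y) q z).
  exact: (trunc_down_comp (f := fun p x => mode x p z)
    (fun p => mode0l p z) (va_trunc va x y)).
have tu1 (x y z : V) : trunc_up (fun p q => Y1 x p (mode y q z) + mode x p (Y1 y q z)).
  apply: trunc_upD; first exact: (trunc_up_comp (fun p => def0r x p) (va_trunc va y z)).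
  exact: (trunc_up_comp (fun p => mode0r x p) (def_trunc hY y z)).
have td1 (x y z : V) : trunc_down (fun p q => Y1 y q (mode x p z) + mode y q (Y1 x p z)).
  apply: trunc_downD; first exact: (trunc_down_comp (fun p => def0r y p) (va_trunc va x z)).
  exact: (trunc_down_comp (fun p => mode0r y p) (def_trunc hY x z)).
have td1' (x y z : V) : trunc_down (fun p q => Y1 (mode x p y) q z + mode (Y1 x p y) q z).
  apply: trunc_downD.
    exact: (trunc_down_comp (f := fun p x => Y1 x p z)
      (fun p => def0l p z) (va_trunc va x y)).
  exact: (trunc_down_comp (f := fun p x => mode x p z)
    (fun p => mode0l p z) (def_trunc hY x y)).
case: u v w => [u0 u1] [v0 v1] [w0 w1].
(* The t-coefficient is the sum of four identities: that of V with t carried by w, v or u in turn,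
   and the deformed one, where t is carried by a vertex operator. *)
have j1 := formal_jacobiD (tu u0 v0 w1) (td u0 v0 w1) (td' u0 v0 w1)
  (tu u0 v1 w0) (td u0 v1 w0) (td' u0 v1 w0)
  (va_jacobi va u0 v0 w1) (va_jacobi va u0 v1 w0).
have j2 := formal_jacobiD (tu u1 v0 w0) (td u1 v0 w0) (td' u1 v0 w0)
  (tu1 u0 v0 w0) (td1 u0 v0 w0) (td1' u0 v0 w0)
  (va_jacobi va u1 v0 w0) (def_jacobi hY u0 v0 w0).
have j := formal_jacobiD
  (trunc_upD (tu u0 v0 w1) (tu u0 v1 w0))
  (trunc_downD (td u0 v0 w1) (td u0 v1 w0))
  (trunc_downD (td' u0 v0 w1) (td' u0 v1 w0))
  (trunc_upD (tu u1 v0 w0) (tu1 u0 v0 w0))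
  (trunc_downD (td u1 v0 w0) (td1 u0 v0 w0))
  (trunc_downD (td' u1 v0 w0) (td1' u0 v0 w0)) j1 j2.
apply: (eq_formal_jacobi _ _ _ j) => p q; rewrite /= ?modeDr ?modeDl.
- rewrite -!addrA; congr (_ + (_ + _)); rewrite addrCA; congr (_ + _).
  by rewrite addrC.
- rewrite -!addrA; congr (_ + _); rewrite [LHS]addrCA; congr (_ + _).
  by rewrite [RHS]addrC addrA.
- rewrite -!addrA; congr (_ + (_ + (_ + _))).
  by rewrite addrC.
Qed.

Lemma dual_axioms : vertex_algebra_axioms dual_data.
Proof.
have DE (v : dual_data) : Dop v = (Dop v.1, Dop v.2).
  rewrite /Dop /mode /= /dual_mode /=; congr pair.
  by rewrite /= (def_vac_r hY) mode0r add0r addr0.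
split.
- exact: dual_grading.
- exact: dual_linear_r.
- exact: dual_linear_l.
- exact: dual_trunc.
- by split; [exact: (va_vac_wt va) | exact: (grading_zero (va_grading va))].
- move=> p q n u v [u1 u2] [v1 v2]; split; first exact: (va_mode_wt va).
  have gD a b m : homog m (a : V) -> homog m b -> homog m (a + b).
    by move=> ha hb; rewrite -[a]scale1r; apply: (grading_lin (va_grading va)).
  by rewrite /=; apply: (@gD); [apply: (@gD); apply: (va_mode_wt va)|apply: (def_wt hY)].
- move=> n [v1 v2]; rewrite /mode /= /dual_mode /= !(va_vacuum va) (def_vac_l hY).
  by rewrite mode0l !addr0; case: ifP.
- move=> [u1 u2]; rewrite /mode /= /dual_mode /= !(va_creation0 va) (def_vac_r hY).
  by rewrite mode0r add0r addr0.
- move=> [u1 u2] n n0; rewrite /mode /= /dual_mode /= !(va_creation va) //.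
  by rewrite (def_vac_r hY) mode0r add0r addr0.
- move=> u v n; rewrite !DE /mode /= /dual_mode /=; congr pair.
    exact: (va_D_comm va).
  rewrite /= -!(va_D_comm va) -(def_D_comm hY).
  rewrite /Dop !modeDl !opprD [LHS]addrACA; congr (_ + _); exact: addrACA.
- move=> u v n; rewrite !DE /mode /= /dual_mode /=; congr pair.
    exact: (va_D_deriv va).
  by rewrite /= !(va_D_deriv va) (def_D_deriv hY) !scalerDr !opprD.
- exact: dual_jacobi.
Qed.

Definition dual_va : vertexAlgebra K := VertexAlgebra dual_axioms.

End DualNumbers.

(** * Weight components and simplicity *)

Section WeightComponents.
Variables (K : numFieldType) (V : vertexAlgebra K).
Implicit Types u v w : V.

Let va := va_axioms V.
Let gr := va_grading va.

Lemma homogD n u v : homog n u -> homog n v -> homog n (u + v).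
Proof. by move=> hu hv; rewrite -[u]scale1r; apply: (grading_lin gr). Qed.

Lemma homogZ n a u : homog n u -> homog n (a *: u).
Proof.
by move=> hu; rewrite -[_ *: _]addr0; apply: (grading_lin gr) (grading_zero gr n).
Qed.

Lemma homog_Dop n v : homog n v -> homog (n + 1) (Dop v).
Proof.
move=> hv; have := va_mode_wt va (-2) hv (va_vac_wt va).
by congr homog; ring.
Qed.

Lemma Dop_linear : linear (@Dop K V).
Proof. exact: (va_linear_l va). Qed.

Fact comp_subproof (v : V) : exists p : seq int * (int -> V),
  [/\ uniq p.1, (forall n, homog n (p.2 n)) & v = \sum_(n <- p.1) p.2 n].
Proof. by have [s [f h]] := grading_span gr v; exists (s, f). Qed.

Definition wt_comp (n : int) (v : V) : V :=
  let p := projT1 (cid (comp_subproof v)) in if n \in p.1 then p.2 n else 0.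

(** [wt_comp] relies on a chosen decomposition; this is its independence of the choice. Two
    decompositions, extended by 0 to a common index set, differ by a vanishing sum of homogeneous
    vectors. *)
Lemma comp_sum (s : seq int) (f : int -> V) n :
  uniq s -> (forall n, homog n (f n)) ->
  wt_comp n (\sum_(m <- s) f m) = if n \in s then f n else 0.
Proof.
move=> us hf; rewrite /wt_comp; case: cid => -[t g] /= [ut hg E].
pose r := undup (s ++ t).
have sr : {subset s <= r} by move=> m ms; rewrite mem_undup mem_cat ms.
have tr : {subset t <= r} by move=> m ms; rewrite mem_undup mem_cat ms orbT.
pose d m := (if m \in t then g m else 0) - (if m \in s then f m else 0).
have hd m : homog m (d m).
  apply: homogD; first by case: ifP => // _; apply: (grading_zero gr).
  rewrite -scaleN1r; apply: homogZ.
  by case: ifP => // _; apply: (grading_zero gr).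
have d0 : \sum_(m <- r) d m = 0.
  rewrite sumrB -(sum_extend f us (undup_uniq _) sr).
  by rewrite -(sum_extend g ut (undup_uniq _) tr) E subrr.
have [nr|nr] := boolP (n \in r).
  have /eqP := grading_free gr (undup_uniq _) hd d0 nr.
  by rewrite subr_eq0 => /eqP.
have -> : n \in t = false by apply: contraNF nr => /tr.
by have -> : n \in s = false by apply: contraNF nr => /sr.
Qed.

Lemma comp_homog n v : homog n (wt_comp n v).
Proof.
rewrite /wt_comp; case: cid => -[t g] /= [ut hg E].
by case: ifP => // _; apply: (grading_zero gr).
Qed.

Lemma comp_id m n v : homog m v -> wt_comp n v = if n == m then v else 0.
Proof.
move=> hv; pose f k := if k == m then v else 0.
have hf k : homog k (f k).
  by rewrite /f; case: eqP => [->//|_]; apply: (grading_zero gr).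
have -> : v = \sum_(k <- [:: m]) f k by rewrite big_seq1 /f eqxx.
rewrite comp_sum // mem_seq1 big_seq1 /f eqxx.
by case: eqP.
Qed.

Lemma comp_linear n : linear (wt_comp n).
Proof.
move=> a u v.
have [s [f [us hf ->]]] := grading_span gr u.
have [t [g [ut hg ->]]] := grading_span gr v.
pose r := undup (s ++ t).
have sr : {subset s <= r} by move=> m ms; rewrite mem_undup mem_cat ms.
have tr : {subset t <= r} by move=> m ms; rewrite mem_undup mem_cat ms orbT.
rewrite !comp_sum // (sum_extend f us (undup_uniq _) sr).
rewrite (sum_extend g ut (undup_uniq _) tr) scaler_sumr -big_split.
rewrite comp_sum ?undup_uniq //; last first.
  move=> m; apply: (grading_lin gr).
    by case: ifP => // _; apply: (grading_zero gr).
  by case: ifP => // _; apply: (grading_zero gr).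
case: ifPn => // nr.
have -> : n \in s = false by apply: contraNF nr => /sr.
have -> : n \in t = false by apply: contraNF nr => /tr.
by rewrite scaler0 addr0.
Qed.

Lemma comp_decomp v : exists2 s : seq int, uniq s & v = \sum_(n <- s) wt_comp n v.
Proof.
have [s [f [us hf E]]] := grading_span gr v; exists s => //.
rewrite {1}E; rewrite big_seq [RHS]big_seq; apply: eq_bigr => n ns.
by rewrite E comp_sum // ns.
Qed.

End WeightComponents.

Lemma comp_morph (K : numFieldType) (U V : vertexAlgebra K) (f : U -> V) (d : int) :
  linear f -> (forall n u, homog n u -> homog (n + d) (f u)) ->
  forall n u, wt_comp (n + d) (f u) = f (wt_comp n u).
Proof.
move=> lf hf n u; have [s us E] := comp_decomp u.
rewrite [in LHS]E (lin_sum lf) (lin_sum (@comp_linear _ V _)).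
rewrite [in RHS]E (lin_sum (@comp_linear _ U _)) (lin_sum lf).
apply: eq_bigr => m _.
rewrite (comp_id _ (hf _ _ (comp_homog m u))) (comp_id _ (comp_homog m u)).
by rewrite (inj_eq (addIr d)); case: eqP; rewrite ?(lin0 lf).
Qed.

Lemma comp_morph0 (K : numFieldType) (U V : vertexAlgebra K) (f : U -> V) :
  linear f -> (forall n u, homog n u -> homog n (f u)) ->
  forall n u, wt_comp n (f u) = f (wt_comp n u).
Proof.
move=> lf hf n u; rewrite -(@comp_morph _ _ _ f 0 lf) ?addr0 // => m v.
by rewrite addr0; apply: hf.
Qed.

Section Subspaces.
Variables (K : numFieldType).

Definition lin_closed (M : lmodType K) (I : M -> Prop) : Prop :=
  I 0 /\ forall (a : K) (u v : M), I u -> I v -> I (a *: u + v).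

Lemma lin_closedD (M : lmodType K) (I : M -> Prop) u v :
  lin_closed I -> I u -> I v -> I (u + v).
Proof. by move=> [_ h] Iu Iv; rewrite -[u]scale1r; apply: h. Qed.

Lemma lin_closedZ (M : lmodType K) (I : M -> Prop) a u :
  lin_closed I -> I u -> I (a *: u).
Proof. by move=> [h0 h] Iu; rewrite -[_ *: _]addr0; apply: h. Qed.

Lemma lin_closed_sum (M : lmodType K) (I : M -> Prop) T (r : seq T) (P : pred T) F :
  lin_closed I -> (forall i, P i -> I (F i)) -> I (\sum_(i <- r | P i) F i).
Proof.
move=> cI IF; apply: big_ind => //; first by case: cI.
by move=> u v; apply: lin_closedD.
Qed.

End Subspaces.

Section GradedSubspaces.
Variables (K : numFieldType) (V : vertexAlgebra K).
Implicit Types (u v w : V) (I : V -> Prop).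

Let va := va_axioms V.

Definition simple_va : Prop := forall J : V -> Prop,
  graded_ideal J -> Defs.proper_ideal J -> forall v, J v -> v = 0.

(* By skew symmetry a subspace stable under all left modes is a two-sided ideal
   as soon as it is stable under D. *)
Inductive Dclosure I : V -> Prop :=
| Dclosure_incl v of I v : Dclosure I v
| Dclosure_Dop v of Dclosure I v : Dclosure I (Dop v)
| Dclosure_lin a u v of Dclosure I u & Dclosure I v : Dclosure I (a *: u + v).

(** Left modes pass D by u_n D v = D (u_n v) - (D u)_n v. For a mode of an element u of the closure,
    skew symmetry writes u_n v through the vectors D^i (v_(n+i) u) / i!. *)
Lemma Dclosure_graded_ideal I : lin_closed I ->
  (forall u n v, I v -> I (mode u n v)) -> (forall n v, I v -> I (wt_comp n v)) ->
  graded_ideal (Dclosure I).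
Proof.
move=> lI mI cI.
have J0 : Dclosure I 0 by apply: Dclosure_incl; case: lI.
have lJ : lin_closed (Dclosure I) by split=> // a u v; apply: Dclosure_lin.
have Jr u n v : Dclosure I v -> Dclosure I (mode u n v).
  move=> Jv; elim: Jv u n => {v} [v Iv|v Jv IH|a v w Jv IHv Jw IHw] u n.
  - by apply: Dclosure_incl; apply: mI.
  - have -> : mode u n (Dop v) = (-1) *: mode (Dop u) n v + Dop (mode u n v).
      by rewrite -(va_D_comm va) scaleN1r opprB subrK.
    by apply: Dclosure_lin => //; apply: Dclosure_Dop.
  - by rewrite modeDr modeZr; apply: Dclosure_lin.
split=> //.
- by move=> a u v; apply: Dclosure_lin.
- move=> u v n Ju.
  (* This vector is D^i w / i!; the step from i to i + 1 divides by i + 1. *)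
  have Jcr w (i : nat) : Dclosure I w -> Dclosure I (mode w (-1 - i%:Z) (vac V)).
    elim: i w => [|i IH] w Jw; first by rewrite subr0 (va_creation0 va).
    have /IH := Dclosure_Dop Jw; rewrite (va_D_deriv va).
    have -> : -1 - i%:Z - 1 = -1 - i.+1%:Z by lia.
    move=> /(lin_closedZ (- ((-1 - i%:Z)%:~R : K)^-1) lJ).
    rewrite scalerN scaleNr opprK scalerA mulVf ?scale1r //.
    by rewrite intr_eq0; lia.
  have : Dclosure I (- ((-1) ^ n *: mode u n v)).
    rewrite skew_symmetry; apply: fsbig_nat_closed => //.
      by move=> x y; apply: lin_closedD.
    by move=> i; apply: lin_closedZ => //; apply: Jcr; apply: Jr.
  move=> /(lin_closedZ (- ((-1) ^ n)^-1) lJ).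
  rewrite scalerN scaleNr opprK scalerA mulVf ?scale1r //.
  by rewrite expfz_eq0 oppr_eq0 oner_eq0 andbF.
- by move=> u v n; apply: Jr.
- have Jc v n : Dclosure I v -> Dclosure I (wt_comp n v).
    move=> Jv; elim: Jv n => {v} [v Iv|v Jv IH|a v w Jv IHv Jw IHw] n.
    + by apply: Dclosure_incl; apply: cI.
    + rewrite -[n](subrK 1) (comp_morph (@Dop_linear _ V)); last exact: homog_Dop.
      by apply: Dclosure_Dop.
    + by rewrite (comp_linear n); apply: Dclosure_lin.
  move=> s f us hf Js n ns.
  by have := Jc _ n Js; rewrite comp_sum // ns.
Qed.

(** The D-closure gains nothing in weight 0, because D raises the weight by 1 and weight -1 is zero.
    So it omits the vacuum and is a proper ideal. *)
Lemma simple_submodule0 I : simple_va -> vac V <> 0 ->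
  (forall n v, n < 0 -> homog n v -> v = 0) ->
  lin_closed I -> (forall u n v, I v -> I (mode u n v)) ->
  (forall n v, I v -> I (wt_comp n v)) -> (forall v, I v -> wt_comp 0 v = 0) ->
  forall v, I v -> v = 0.
Proof.
move=> sV vac0 neg lI mI cI I0 v Iv.
apply: (sV (Dclosure I)) (Dclosure_incl Iv).
  exact: Dclosure_graded_ideal.
exists (vac V) => Jvac.
have J0 w : Dclosure I w -> wt_comp 0 w = 0.
  elim=> {w} [w /I0//|w _ _|a u w _ IHu _ IHw]; last first.
    by rewrite (comp_linear 0) IHu IHw scaler0 addr0.
  have -> : wt_comp 0 (Dop w) = Dop (wt_comp (-1) w).
    exact: (comp_morph (@Dop_linear _ V) (@homog_Dop _ V) (-1) w).
  by rewrite (neg (-1) (wt_comp (-1) w)) ?(lin0 (@Dop_linear _ V)) //; apply: comp_homog.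
by have := J0 _ Jvac; rewrite (comp_id 0 (va_vac_wt va)).
Qed.

End GradedSubspaces.

(** * The standard basis of sl2 *)

Inductive gen := E | H | F.

Definition gen_code (x : gen) : option bool :=
  match x with E => Some true | H => None | F => Some false end.
Definition gen_decode (o : option bool) : gen :=
  match o with Some true => E | None => H | Some false => F end.
Lemma gen_codeK : cancel gen_code gen_decode. Proof. by case. Qed.
HB.instance Definition _ := Equality.copy gen (can_type gen_codeK).

(* [gen_bracket x y = (c, z)] encodes [x, y] = c z *)
Definition gen_bracket (x y : gen) : int * gen :=
  match x, y with
  | E, F => (1, H) | F, E => (-1, H)
  | H, E => (2, E) | E, H => (-2, E)
  | H, F => (-2, F) | F, H => (2, F)
  | _, _ => (0, H)
  end.

Definition gen_form (x y : gen) : int :=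
  match x, y with E, F | F, E => 1 | H, H => 2 | _, _ => 0 end.

Section Sl2Basis.
Variable K : numFieldType.

Definition gen_mx (x : gen) : 'M[K]_2 :=
  match x with
  | E => \matrix_(i, j) ((i == 0) && (j == 1))%:R
  | H => \matrix_(i, j) (((i == 0) && (j == 0))%:R - ((i == 1) && (j == 1))%:R)
  | F => \matrix_(i, j) ((i == 1) && (j == 0))%:R
  end.

Fact gen_traceless x : gen_mx x \in @traceless K.
Proof.
by case: x; rewrite inE /mxtrace !big_ord_recl big_ord0 !mxE /= ?subr0 ?sub0r
  ?addr0 ?subrr.
Qed.

Definition sl2_gen (x : gen) : sl2 K := Sl2 (gen_traceless x).

Lemma matrix2P (A B : 'M[K]_2) :
  [/\ A 0 0 = B 0 0, A 0 1 = B 0 1, A 1 0 = B 1 0 & A 1 1 = B 1 1] -> A = B.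
Proof.
move=> [h00 h01 h10 h11]; apply/matrixP => i j.
have I2 (k : 'I_2) : k = 0 \/ k = 1.
  by case: k => -[|[|//]] lt; [left|right]; apply: val_inj.
by case: (I2 i) => ->; case: (I2 j) => ->.
Qed.

Lemma sl2_decomp (a : sl2 K) :
  a = sl2_mx a 0 1 *: sl2_gen E + sl2_mx a 0 0 *: sl2_gen H
      + sl2_mx a 1 0 *: sl2_gen F.
Proof.
apply: val_inj; apply: matrix2P.
have := sl2P a; rewrite inE /mxtrace !big_ord_recl big_ord0 addr0.
rewrite (_ : lift ord0 ord0 = 1); last exact: val_inj.
rewrite addrC addr_eq0 => /eqP h11; split; rewrite ?h11 /= !mxE /=; ring.
Qed.

Lemma bracket_gen x y : bracket (sl2_gen x) (sl2_gen y) =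
  (gen_bracket x y).1%:~R *: sl2_gen (gen_bracket x y).2.
Proof.
apply: val_inj; apply: matrix2P.
have l1 : lift ord0 ord0 = 1 :> 'I_2 by apply: val_inj.
by case: x; case: y; split; rewrite /= !mxE !big_ord_recl !big_ord0 /= !l1 !mxE /=;
  ring.
Qed.

Lemma trace_form_gen x y : trace_form (sl2_gen x) (sl2_gen y) = (gen_form x y)%:~R.
Proof.
have l1 : lift ord0 ord0 = 1 :> 'I_2 by apply: val_inj.
by case: x; case: y; rewrite /trace_form /mxtrace !big_ord_recl !big_ord0 /= !l1 !mxE
  !big_ord_recl !big_ord0 /= !l1 !mxE /=; ring.
Qed.

End Sl2Basis.

(** * Quotients of universal affine vertex algebras *)

Section AffineQuotients.
Variables (K : numFieldType) (k : K).

(** The part of [universal_affine] that passes to quotients, so that the same lemmas serve V^k and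
    its simple quotient. *)
Record affine_quotient (V : vertexAlgebra K) (iota : {linear sl2 K -> V}) : Prop := {
  aq_module : affine_module k (affine_mode iota);
  aq_vac : forall (a : sl2 K) (n : int), 0 <= n -> affine_mode iota a n (vac V) = 0;
  aq_span : forall v : V, exists s : seq (K * seq (sl2 K * nat)),
    v = \sum_(x <- s) x.1 *: affine_word iota x.2;
  aq_weight : forall s : seq (sl2 K * nat),
    homog (\sum_(x <- s) x.2.+1)%N%:Z (affine_word iota s)
}.

Lemma universal_affine_quotient (U : vertexAlgebra K) (iota : {linear sl2 K -> U}) :
  universal_affine k iota -> affine_quotient iota.
Proof. by case. Qed.

Section SimpleQuotient.
Variables (U V : vertexAlgebra K) (iota : {linear sl2 K -> U}) (pi : {linear U -> V}).
Hypotheses (hU : affine_quotient iota) (hpi : simple_quotient pi).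

Definition quotient_iota : {linear sl2 K -> V} := (pi \o iota)%FUN.

Lemma quotient_affine_mode a n u :
  affine_mode quotient_iota a n (pi u) = pi (affine_mode iota a n u).
Proof. by case: hpi => -[_ hm _] _ _; rewrite /affine_mode hm. Qed.

Lemma quotient_vac : pi (vac U) = vac V.
Proof. by case: hpi => -[]. Qed.

Lemma quotient_surj v : exists u, v = pi u.
Proof. by case: hpi => _ sur _; have [u <-] := sur v; exists u. Qed.

Lemma quotient_affine_word s : affine_word quotient_iota s = pi (affine_word iota s).
Proof.
elim: s => [|x s IH] /=; first by rewrite quotient_vac.
by rewrite IH quotient_affine_mode.
Qed.

Lemma quotient_affine_quotient : affine_quotient quotient_iota.
Proof.
have [am av asp aw] := hU; split.
- have [h1 h2 h3] := am; split.
  + by move=> a n; apply: mode_lin_r.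
  + by move=> n w c a b; rewrite /affine_mode linearP modeDl modeZl.
  + move=> a b m n w; have [u ->] := quotient_surj w.
    by rewrite !quotient_affine_mode -linearB h3 linearD linearZ.
- by move=> a n n0; rewrite -quotient_vac quotient_affine_mode av // linear0.
- move=> v; have [u ->] := quotient_surj v; have [s ->] := asp u; exists s.
  rewrite linear_sum; apply: eq_bigr => x _.
  by rewrite linearZ quotient_affine_word.
- by move=> s; rewrite quotient_affine_word; case: hpi => -[_ _ hw] _ _; apply: hw.
Qed.

Lemma quotient_vac_neq0 : vac V <> 0.
Proof.
move=> v0; case: hpi => _ _ [hJ [u]] hu _; apply: hu.
have <- : mode (vac U) (-1) u = u by rewrite (va_vacuum (va_axioms U)).
by apply: (ideal_mode_l hJ); rewrite quotient_vac.
Qed.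

(** The preimage of a proper graded ideal is again one, hence lies in the kernel of [pi]. *)
Lemma quotient_simple : simple_va V.
Proof.
move=> J hJ [v0 Jv0] v Jv; case: hpi => -[hv hm hw] sur [_ _ hmax].
have [u E] := quotient_surj v; rewrite E.
apply: (hmax (fun u => J (pi u))); last by rewrite -E.
- split.
  + by rewrite linear0; apply: (ideal_zero hJ).
  + by move=> a x y Jx Jy; rewrite linearP; apply: (ideal_lin hJ).
  + by move=> x y n Jx; rewrite hm; apply: (ideal_mode_l hJ).
  + by move=> x y n Jx; rewrite hm; apply: (ideal_mode_r hJ).
  + move=> s f us hf; rewrite linear_sum => Js n ns.
    exact: (ideal_graded hJ (f := fun m => pi (f m)) us (fun m => hw _ _ (hf m)) Js ns).
- by have [u0 E0] := quotient_surj v0; exists u0; rewrite -E0.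
Qed.

End SimpleQuotient.

Section Words.
Variables (V : vertexAlgebra K) (iota : {linear sl2 K -> V}).
Hypothesis hV : affine_quotient iota.

Lemma affine_mode_vac a : affine_mode iota a (-1) (vac V) = iota a.
Proof. exact: (va_creation0 (va_axioms V)). Qed.

Lemma iota_homog a : homog 1 (iota a).
Proof.
rewrite -affine_mode_vac; have := aq_weight hV [:: (a, 0%N)].
by rewrite big_seq1.
Qed.

Lemma affine_mode_homog a n m v : homog m v -> homog (m - n) (affine_mode iota a n v).
Proof.
move=> hv; have := va_mode_wt (va_axioms V) n (iota_homog a) hv.
by congr homog; ring.
Qed.

Lemma affine_word_ind (Q : V -> Prop) : lin_closed Q ->
  (forall s, Q (affine_word iota s)) -> forall v, Q v.
Proof.
move=> lQ Qs v; have [s ->] := aq_span hV v.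
by apply: lin_closed_sum => // x _; apply: lin_closedZ.
Qed.

(** Projecting a spanning expression to weight n discards the words of all other weights. *)
Lemma homog_affine_word_ind (n : int) (Q : V -> Prop) : lin_closed Q ->
  (forall s, (\sum_(x <- s) x.2.+1)%N%:Z = n -> Q (affine_word iota s)) ->
  forall v, homog n v -> Q v.
Proof.
move=> lQ Qs v hv; have := comp_id n hv; rewrite eqxx => <-.
have [s ->] := aq_span hV v.
rewrite (lin_sum (@comp_linear _ V n)); apply: lin_closed_sum => // x _.
rewrite (linZ (@comp_linear _ V n)) (comp_id _ (aq_weight hV x.2)).
apply: lin_closedZ => //.
by case: eqP => [/esym|_]; [exact: Qs | case: lQ].
Qed.

Lemma negative_weight0 n (v : V) : n < 0 -> homog n v -> v = 0.
Proof.
move=> n0; move: v; apply: (homog_affine_word_ind (Q := fun v => v = 0)).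
  by split=> // a u w -> ->; rewrite scaler0 addr0.
by move=> s E; move: n0; rewrite -E.
Qed.

Lemma weight0_vac (v : V) : homog 0 v -> exists c : K, v = c *: vac V.
Proof.
move: v; apply: homog_affine_word_ind => [|[|x s] E].
- split; first by exists 0; rewrite scale0r.
  move=> a u w [c ->] [d ->]; exists (a * c + d).
  by rewrite scalerDl scalerA.
- by exists 1; rewrite scale1r.
- by move: E; rewrite big_cons.
Qed.

Lemma weight1_iota (v : V) : homog 1 v -> exists a, v = iota a.
Proof.
move: v; apply: homog_affine_word_ind => [|[|x [|y s]] E].
- split; first by exists 0; rewrite linear0.
  move=> a u w [c ->] [d ->]; exists (a *: c + d).
  by rewrite linearP.
- by move: E; rewrite big_nil.
- move: E; rewrite big_seq1; case: x => a [|//] _; exists a.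
  exact: affine_mode_vac.
- by move: E; rewrite !big_cons; lia.
Qed.

(** Associativity expresses the modes of a(-n) w through those of a and of w, so induction on words
    applies. *)
Lemma affine_closed_modes (I : V -> Prop) : lin_closed I ->
  (forall a n v, I v -> I (affine_mode iota a n v)) ->
  forall u n v, I v -> I (mode u n v).
Proof.
move=> lI aI; apply: affine_word_ind.
  split; first by move=> n v _; rewrite mode0l; case: lI.
  move=> a u w hu hw n v Iv; rewrite modeDl modeZl.
  by case: lI => _; apply; [apply: hu | apply: hw].
elim=> [|x s IH] n v Iv /=.
  by rewrite (va_vacuum (va_axioms V)); case: ifP => // _; case: lI.
have addI := @lin_closedD _ _ _ _ _ lI.
rewrite /affine_mode associativity_formula -scaleN1r addrC; case: (lI) => I0; apply.
  apply: fsbig_nat_closed => // i; apply: lin_closedZ => //.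
  by apply: IH; apply: aI.
apply: fsbig_nat_closed => // i; apply: lin_closedZ => //.
by apply: aI; apply: IH.
Qed.

Definition gen_mode (x : gen) (n : int) (v : V) : V :=
  affine_mode iota (sl2_gen K x) n v.

Definition gen_word (s : seq (gen * nat)) : V :=
  foldr (fun x v => gen_mode x.1 (- (x.2.+1)%:Z) v) (vac V) s.

Lemma gen_closed (I : V -> Prop) n v : lin_closed I ->
  (forall x, I (gen_mode x n v)) -> forall a, I (affine_mode iota a n v).
Proof.
move=> lI gI a; rewrite [a]sl2_decomp /affine_mode !linearD !linearZ /=.
rewrite !modeDl !modeZl.
by do 2?[apply: lin_closedD => //]; apply: lin_closedZ => //; apply: gI.
Qed.

Lemma homog_gen_word_ind (n : int) (Q : V -> Prop) : lin_closed Q ->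
  (forall s, (\sum_(x <- s) x.2.+1)%N%:Z = n -> Q (gen_word s)) ->
  forall v, homog n v -> Q v.
Proof.
move=> lQ Qs; apply: homog_affine_word_ind => // s E.
(* Multilinear expansion in the basis changes the letters but keeps the sequence of degrees, so the
   claim is generalized to all words with the degrees of [s]. *)
have {E} : forall t, [seq x.2 | x <- t] = [seq x.2 | x <- s] -> Q (gen_word t).
  move=> t st; apply: Qs; rewrite -E.
  by rewrite -(big_map snd xpredT (fun i => i.+1)) st big_map.
elim: s Q lQ {Qs} => [|[a i] s IH] Q lQ Qs /=; first exact: Qs [::] _.
have lQ' b : lin_closed (fun v => Q (affine_mode iota b (- (i.+1)%:Z) v)).
  split; first by rewrite /affine_mode mode0r; case: lQ.
  by move=> c u w Qu Qw; rewrite /affine_mode modeDr modeZr; apply: (lQ.2).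
apply: (IH (fun v => Q (affine_mode iota a _ v))) => // t st.
by apply: gen_closed => // x; apply: (Qs ((x, i) :: t)); rewrite /= st.
Qed.

Lemma gen_mode_comm x y m n v :
  gen_mode x m (gen_mode y n v) - gen_mode y n (gen_mode x m v) =
  (gen_bracket x y).1%:~R *: gen_mode (gen_bracket x y).2 (m + n) v
  + (if m + n == 0 then (m * gen_form x y)%:~R else 0) *: (k *: v).
Proof.
have [_ hl hc] := aq_module hV.
rewrite /gen_mode hc bracket_gen trace_form_gen (linZ (hl _ _)); congr (_ + _).
by rewrite scalerA; case: ifP => _; rewrite ?mul0r // intrM.
Qed.

End Words.

End AffineQuotients.

(** * Evaluation of affine words *)

Local Notation Z := BinNums.Z.
Notation letter := (gen * int)%type.

(* The triple (c, j, w) stands for c C^j w, where C is the central element of the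
   affine Lie algebra and the word w is a product of elements x(n). *)
Notation combination := (seq (Z * nat * seq letter)).

(** A PBW order, by degree first and then H, E, F. The words of [singular] are sorted in it. *)
Definition letter_le (l l' : letter) : bool :=
  let rank x : nat := match x with H => 0 | E => 1 | F => 2 end in
  (l.2 < l'.2) || (l.2 == l'.2) && (rank l.1 <= rank l'.1)%N.

(** Evaluates x(n) w 1 by moving x(n) to the right with x(n) l = l x(n) + [x(n), l], until it is in
    order or, for n >= 0, is killed by the vacuum. The summands are l x(n) w', the Lie bracket and
    the central term. *)
Fixpoint push (x : gen) (n : int) (w : seq letter) : combination :=
  match w with
  | [::] => if n < 0 then [:: (1, 0%N, [:: (x, n)])] else [::]
  | l :: w' =>
    if (n < 0) && letter_le (x, n) l then [:: (1, 0%N, (x, n) :: w)] else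
    [seq (t.1, l :: t.2) | t <- push x n w'] ++
    let b := gen_bracket x l.1 in
    (if b.1 == 0 then [::] else
     [seq (Z_of_int b.1 * t.1.1, t.1.2, t.2) | t <- push b.2 (n + l.2) w']) ++
    (if n + l.2 == 0 then [:: (Z_of_int (n * gen_form x l.1), 1%N, w')] else [::])
  end.

Definition scale_comb (c : Z) (j : nat) (L : combination) : combination :=
  [seq (c * t.1.1, (j + t.1.2)%N, t.2) | t <- L].

Definition push_comb (l : letter) (L : combination) : combination :=
  flatten [seq scale_comb t.1.1 t.1.2 (push l.1 l.2 t.2) | t <- L].

Definition mul_comb (Q L : combination) : combination :=
  flatten [seq scale_comb q.1.1 q.1.2 (foldr push_comb L q.2) | q <- Q].

Definition normalize (L : combination) : combination :=
  mul_comb L [:: (1, 0%N, [::])].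

Fixpoint collect1 (c : Z) (w : seq letter) (acc : seq (Z * seq letter)) :=
  match acc with
  | [::] => [:: (c, w)]
  | p :: acc' =>
    if w == p.2 then (c + p.1, w) :: acc' else p :: collect1 c w acc'
  end.

(* 27 c C^j at C = -4/3, for j <= 3 *)
Definition value27 (c : Z) (j : nat) : Z := c * (-4) ^+ j * 3 ^+ (3 - j).

(* 9 times the derivative of c C^j at C = -4/3, for j <= 3 *)
Definition deriv9 (c : Z) (j : nat) : Z := c * j%:R * (-4) ^+ j.-1 * 3 ^+ (3 - j).

(** A sufficient test: words are compared literally, so unsorted words may hide a cancellation. The
    bound on the exponents keeps [value27] within its range. *)
Definition vanishes (L : combination) : bool :=
  all (fun t => t.1.2 <= 3)%N L &&
  all (fun p => p.1 == 0)
    (foldr (fun t acc => collect1 (value27 t.1.1 t.1.2) t.2 acc) [::] L).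

(* 36 times the singular vector of weight 3 in the universal algebra of level -4/3 *)
Definition singular : combination :=
  [:: (-16, 0%N, [:: (E, -3)]);
      (-6, 0%N, [:: (H, -2); (E, -1)]);
      (-48, 0%N, [:: (E, -2); (H, -1)]);
      (9, 0%N, [:: (H, -1); (H, -1); (E, -1)]);
      (36, 0%N, [:: (E, -1); (E, -1); (F, -1)])].

(* the image under the anti-involution e(n) <-> f(-n), h(n) <-> h(-n) *)
Definition cosingular : combination :=
  let flip x := match x with E => F | H => H | F => E end in
  [seq (t.1, rev [seq (flip l.1, - l.2) | l <- t.2]) | t <- singular].

Definition gens := [:: E; H; F].

(* [push] does not sort the words it produces by commutation, hence the two further
   passes of [normalize]. *)
Lemma singular_annihilated :
  all (fun x => vanishes
    (normalize (normalize (mul_comb [:: (1, 0%N, [:: (x, 1)])] singular)))) gens.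
Proof. by vm_compute. Qed.

Definition kills (w : seq letter) : bool :=
  vanishes (mul_comb cosingular [:: (1, 0%N, w)]).

(** In terms of the contravariant form, P' w 1 is the pairing of w 1 with the singular vector, which
    lies in the radical. The results are words of weight 0 in negative modes, that is, multiples of
    the vacuum. *)
Lemma cosingular_weight3 :
  [&& all (fun x => kills [:: (x, -3)]) gens,
      all (fun x => all (fun y => kills [:: (x, -2); (y, -1)]) gens) gens,
      all (fun x => all (fun y => kills [:: (x, -1); (y, -2)]) gens) gens &
      all (fun x => all (fun y => all (fun z =>
        kills [:: (x, -1); (y, -1); (z, -1)]) gens) gens) gens].
Proof. by vm_compute. Qed.

(** For weight reasons only empty words survive, so the product is p(C) 1. The second part says that
    the derivative of p at -4/3 is nonzero. *)
Lemma cosingular_singular :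
  let L := mul_comb cosingular singular in
  all (fun t => (t.1.2 <= 3)%N && (t.2 == [::])) L &&
  (foldr (fun t s => deriv9 t.1.1 t.1.2 + s) 0 L != 0).
Proof. by vm_compute. Qed.

(** The calculus uses binary integers so that [vm_compute] is fast; its coefficients are sent to [K]
    here. *)
Definition intZ (K : numFieldType) (c : Z) : K := (int_of_Z c)%:~R.

(** * Soundness of the word calculus for an arbitrary central operator *)

Section Soundness.
Variables (K : numFieldType) (M : lmodType K).
Variables (op : gen -> int -> M -> M) (C : M -> M) (vac : M).
Hypothesis op_linear : forall x n, linear (op x n).
Hypothesis C_linear : linear C.
Hypothesis op_C : forall x n v, op x n (C v) = C (op x n v).
Hypothesis op_comm : forall x y m n v,
  op x m (op y n v) - op y n (op x m v) =
  (gen_bracket x y).1%:~R *: op (gen_bracket x y).2 (m + n) v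
  + (if m + n == 0 then (m * gen_form x y)%:~R else 0) *: C v.
Hypothesis op_vac : forall x n, 0 <= n -> op x n vac = 0.

Local Notation intZ := (intZ K).

Lemma intZD c d : intZ (c + d) = intZ c + intZ d.
Proof. by rewrite /intZ rmorphD intrD. Qed.
Lemma intZM c d : intZ (c * d) = intZ c * intZ d.
Proof. by rewrite /intZ rmorphM intrM. Qed.

Lemma intZX c n : intZ (c ^+ n) = intZ c ^+ n.
Proof. by rewrite /intZ !rmorphXn. Qed.
Lemma intZ_nat n : intZ n%:R = n%:R.
Proof. by rewrite /intZ !rmorph_nat. Qed.
Lemma intZ_oppnat n : intZ (- n%:R) = - n%:R.
Proof. by rewrite /intZ !rmorphN !rmorph_nat. Qed.

Definition op_word (w : seq letter) (v : M) : M := foldr (fun l v => op l.1 l.2 v) v w.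

Definition comb_act (L : combination) (v : M) : M :=
  \sum_(t <- L) intZ t.1.1 *: iter t.1.2 C (op_word t.2 v).

Lemma iterC_linear j : linear (iter j C).
Proof. by elim: j => [|j IH] a u v //=; rewrite IH C_linear. Qed.

Lemma op_word_linear w : linear (op_word w).
Proof. by elim: w => [|l w IH] a u v //=; rewrite IH op_linear. Qed.

Lemma op_iterC x n j v : op x n (iter j C v) = iter j C (op x n v).
Proof. by elim: j => //= j <-; rewrite op_C. Qed.

Lemma comb_act_linear L : linear (comb_act L).
Proof.
move=> a u v; rewrite /comb_act scaler_sumr -big_split; apply: eq_bigr => t _ /=.
by rewrite op_word_linear iterC_linear scalerDr !scalerA mulrC.
Qed.

Lemma comb_act_cat L L' v : comb_act (L ++ L') v = comb_act L v + comb_act L' v.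
Proof. by rewrite /comb_act big_cat. Qed.

Lemma comb_act1 c j w v : comb_act [:: (c, j, w)] v = intZ c *: iter j C (op_word w v).
Proof. by rewrite /comb_act big_seq1. Qed.

Lemma comb_act_scale c j L v :
  comb_act (scale_comb c j L) v = intZ c *: iter j C (comb_act L v).
Proof.
rewrite /comb_act big_map (lin_sum (iterC_linear j)) scaler_sumr.
apply: eq_bigr => t _; rewrite intZM iterD (linZ (iterC_linear j)).
by rewrite scalerA.
Qed.

Lemma push_sound x n w : op x n (op_word w vac) = comb_act (push x n w) vac.
Proof.
elim: w x n => [|[y m] w IH] x n /=.
  case: ltP => [_|/op_vac->]; last by rewrite /comb_act big_nil.
  by rewrite comb_act1 scale1r.
case: ifP => _; first by rewrite comb_act1 scale1r.
rewrite -[LHS](subrK (op y m (op x n (op_word w vac)))) op_comm addrC.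
rewrite !comb_act_cat; congr (_ + (_ + _)).
- rewrite IH /comb_act (lin_sum (op_linear _ _)) big_map; apply: eq_bigr => t _.
  by rewrite (linZ (op_linear _ _)) op_iterC.
- rewrite IH; case: eqP => [->|_]; first by rewrite scale0r /comb_act big_nil.
  rewrite /comb_act big_map scaler_sumr; apply: eq_bigr => t _ /=.
  by rewrite intZM scalerA /intZ Z_of_intK.
- case: ifP => _; last by rewrite scale0r /comb_act big_nil.
  by rewrite comb_act1 /intZ Z_of_intK.
Qed.

Lemma push_comb_sound l L :
  op l.1 l.2 (comb_act L vac) = comb_act (push_comb l L) vac.
Proof.
rewrite /push_comb; elim: L => [|t L IH] /=.
  by rewrite /comb_act !big_nil (lin0 (op_linear _ _)).
rewrite comb_act_cat comb_act_scale -push_sound -IH.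
rewrite /comb_act big_cons (linD (op_linear _ _)) (linZ (op_linear _ _)).
by rewrite op_iterC.
Qed.

Lemma mul_comb_sound Q L : comb_act Q (comb_act L vac) = comb_act (mul_comb Q L) vac.
Proof.
rewrite /mul_comb; elim: Q => [|q Q IH] /=; first by rewrite /comb_act !big_nil.
rewrite comb_act_cat comb_act_scale -IH.
suff <- : op_word q.2 (comb_act L vac) = comb_act (foldr push_comb L q.2) vac.
  by rewrite {1}/comb_act big_cons.
by elim: q.2 => //= l w ->; rewrite push_comb_sound.
Qed.

Lemma normalize_sound L : comb_act L vac = comb_act (normalize L) vac.
Proof. by rewrite -mul_comb_sound comb_act1 scale1r. Qed.

Lemma vanishes_sound L : (forall v, C v = (- (4 / 3)) *: v) -> vanishes L ->
  comb_act L vac = 0.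
Proof.
move=> CE /andP[L3 L0].
have iterCE j v : iter j C v = (- (4 / 3)) ^+ j *: v.
  by elim: j => [|j IH] /=; rewrite ?scale1r // IH CE scalerA exprS.
pose val (acc : seq (Z * seq letter)) := \sum_(p <- acc) intZ p.1 *: op_word p.2 vac.
have val1 c w acc : val (collect1 c w acc) = intZ c *: op_word w vac + val acc.
  elim: acc => [|p acc IH] /=; first by rewrite /val !big_cons.
  case: eqP => [->|_].
    by rewrite /val !big_cons /= intZD scalerDl addrA.
  by rewrite /val !big_cons -!/(val _) IH addrCA.
suff : 27%:R *: comb_act L vac = 0.
  by move=> /eqP; rewrite scaler_eq0 pnatr_eq0 => /eqP.
transitivity (val (foldr (fun t acc =>
    collect1 (value27 t.1.1 t.1.2) t.2 acc) [::] L)); last first.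
  rewrite /val big_seq big1 // => p pL.
  by have /eqP -> := allP L0 _ pL; rewrite /intZ scale0r.
elim: L L3 {L0} => [_|t L IH /= /andP[t3 L3]].
  by rewrite /val /comb_act !big_nil scaler0.
rewrite val1 -IH // /comb_act big_cons scalerDr; congr (_ + _).
rewrite iterCE !scalerA; congr (_ *: _).
rewrite /value27 !intZM !intZX intZ_oppnat intZ_nat.
by case: t.1.2 t3 => [|[|[|[|//]]]] _; field.
Qed.

End Soundness.

(** * The singular vector at level -4/3 *)

Definition letters_weight (w : seq letter) : int := foldr (fun l n => n - l.2) 0 w.

Definition letters_of (s : seq (gen * nat)) : seq letter :=
  [seq (x.1, - (x.2.+1)%:Z) | x <- s].

(** The four cases are the compositions 3, 2 + 1, 1 + 2 and 1 + 1 + 1. *)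
Lemma weight3_words (Q : pred (seq letter)) :
  [&& all (fun x => Q [:: (x, -3)]) gens,
      all (fun x => all (fun y => Q [:: (x, -2); (y, -1)]) gens) gens,
      all (fun x => all (fun y => Q [:: (x, -1); (y, -2)]) gens) gens &
      all (fun x => all (fun y => all (fun z =>
        Q [:: (x, -1); (y, -1); (z, -1)]) gens) gens) gens] ->
  forall s : seq (gen * nat), (\sum_(x <- s) x.2.+1)%N%:Z = 3 -> Q (letters_of s).
Proof.
move=> /and4P[c3 c21 c12 c111] s.
have gP x : x \in gens by case: x.
case: s => [|[x i] [|[y j] [|[z l] s]]]; rewrite ?big_nil ?big_cons ?big_nil //.
- by case: i => [|[|[|i]]] //= _; apply: (allP c3 _ (gP x)).
- case: i => [|[|i]]; case: j => [|[|j]] //= wt; try by lia.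
  + exact: (allP (allP c12 _ (gP x)) _ (gP y)).
  + exact: (allP (allP c21 _ (gP x)) _ (gP y)).
- case: i => [|i] /=; last by lia.
  case: j => [|j] /=; last by lia.
  case: l => [|l] /=; last by lia.
  case: s => [|[t m] s]; last by rewrite big_cons /=; lia.
  by move=> _; apply: (allP (allP (allP c111 _ (gP x)) _ (gP y)) _ (gP z)).
Qed.

Lemma comb_act_homog (K : numFieldType) (V : vertexAlgebra K)
    (op : gen -> int -> V -> V) (C : V -> V) (v : V) (d : int) (L : combination) :
  (forall x n m w, homog m w -> homog (m - n) (op x n w)) ->
  (forall m w, homog m w -> homog m (C w)) ->
  homog 0 v -> all (fun t => letters_weight t.2 == d) L ->
  homog d (comb_act op C L v).
Proof.
move=> hop hC hv /allP hL; rewrite /comb_act big_seq.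
apply: (big_ind (homog d)); first exact: (grading_zero (va_grading (va_axioms V))).
  by move=> x y; apply: homogD.
move=> t /hL/eqP <-; apply: homogZ.
elim: t.1.2 => [|j IH] /=; last exact: hC.
by elim: t.2 => [|l w IH] //=; apply: hop.
Qed.

Lemma singular_weight : all (fun t => letters_weight t.2 == 3) singular.
Proof. by []. Qed.

Section CriticalLevel.
Variables (K : numFieldType) (V : vertexAlgebra K) (iota : {linear sl2 K -> V}).
Hypothesis hV : affine_quotient (- (4 / 3)) iota.
Hypotheses (sV : simple_va V) (vac0 : vac V <> 0).

Local Notation k := (- (4 / 3) : K).
Local Notation op := (gen_mode iota).
Local Notation act := (comb_act op (fun v : V => k *: v)).

Lemma gen_mode_linear x n : linear (op x n).
Proof. exact: mode_lin_r. Qed.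

Lemma level_linear : linear (fun v : V => k *: v).
Proof. by move=> a u v; rewrite scalerDr !scalerA mulrC. Qed.

Lemma gen_mode_level x n (v : V) : op x n (k *: v) = k *: op x n v.
Proof. exact: modeZr. Qed.

Lemma gen_mode_vac x n : 0 <= n -> op x n (vac V) = 0.
Proof. exact: (aq_vac hV). Qed.

Lemma gen_mode_homog x n m (v : V) : homog m v -> homog (m - n) (op x n v).
Proof. exact: (affine_mode_homog hV). Qed.

Local Notation opc := (gen_mode_comm hV).

(** Since sl2 = [sl2, sl2], an element of degree n + 1 is, up to a central term, a commutator of
    elements of degrees n and 1. Annihilation by all positive modes thus reduces to degree 1. *)
Lemma sl2_gen_perfect x n (v : V) : op x (n + 1) v =
  match x with
  | E => (- 2%:R^-1) *: (op E n (op H 1 v) - op H 1 (op E n v))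
  | H => op E n (op F 1 v) - op F 1 (op E n v)
         - (if n + 1 == 0 then (n * gen_form E F)%:~R else 0) *: (k *: v)
  | F => 2%:R^-1 *: (op F n (op H 1 v) - op H 1 (op F n v))
  end.
Proof.
case: x; rewrite opc /=.
- rewrite mulr0 mulr0z if_same scale0r addr0 scalerA.
  by rewrite (_ : _ * _ = 1) ?scale1r //; field.
- by rewrite scale1r addrK.
- rewrite mulr0 mulr0z if_same scale0r addr0 scalerA.
  by rewrite (_ : _ * _ = 1) ?scale1r //; field.
Qed.

(** The submodule generated by the singular vector. Only modes of degree n <= 0 are adjoined, so
    that it visibly stays in weights at least 3. *)
Inductive singular_span : V -> Prop :=
| singular_span0 : singular_span (act singular (vac V))
| singular_span_lin a u v of singular_span u & singular_span v :
    singular_span (a *: u + v)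
| singular_span_op x n u of n <= 0 & singular_span u : singular_span (op x n u).

Lemma singular_op1 x : op x 1 (act singular (vac V)) = 0.
Proof.
have snd := mul_comb_sound gen_mode_linear level_linear gen_mode_level opc gen_mode_vac.
have nrm := normalize_sound gen_mode_linear level_linear gen_mode_level opc gen_mode_vac.
transitivity (act [:: (1, 0%N, [:: (x, 1)])] (act singular (vac V))).
  by rewrite comb_act1 /intZ scale1r.
rewrite snd nrm nrm; apply: vanishes_sound => //.
by apply: (allP singular_annihilated); case: x.
Qed.

Lemma singular_op_gt0 x n : 0 < n -> op x n (act singular (vac V)) = 0.
Proof.
case: n => [[//|n]|//] _; elim: n x => [|n IH] x; first exact: singular_op1.
rewrite (_ : n.+2%:Z = n.+1%:Z + 1); last by lia.
rewrite (sl2_gen_perfect x n.+1%:Z) (_ : (n.+1%:Z + 1 == 0) = false); last by lia.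
rewrite scale0r.
by case: x; rewrite !singular_op1 !IH /gen_mode /affine_mode !mode0r subrr ?scaler0
  ?subr0.
Qed.

Lemma singular_span_closed : lin_closed singular_span.
Proof.
have S0 : singular_span 0.
  have := singular_span_lin (-1) singular_span0 singular_span0.
  by rewrite scaleN1r addNr.
by split=> // a u v; apply: singular_span_lin.
Qed.

(** Positive modes are commuted to the right until they reach the singular vector, which they
    kill. *)
Lemma singular_span_gen x n u : singular_span u -> singular_span (op x n u).
Proof.
have lS := singular_span_closed.
move=> Su; elim: Su x n => {u} [|a u v Su IHu Sv IHv|y m u m0 Su IH] x n.
- case: (lerP n 0) => n0; first by apply: singular_span_op => //; apply: singular_span0.
  by rewrite singular_op_gt0 //; case: lS.
- by rewrite gen_mode_linear; apply: singular_span_lin.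
- rewrite -[op x n _](subrK (op y m (op x n u))) opc.
  apply: lin_closedD => //; last exact: singular_span_op.
  apply: lin_closedD => //; first exact: lin_closedZ.
  by do 2!apply: lin_closedZ => //.
Qed.

Lemma act_singular_homog : homog 3 (act singular (vac V)).
Proof.
apply: comb_act_homog singular_weight => //.
- by move=> x n m w; apply: gen_mode_homog.
- by move=> m w; apply: homogZ.
- exact: (va_vac_wt (va_axioms V)).
Qed.

Lemma comp_gen_mode m x n (v : V) : wt_comp m (op x n v) = op x n (wt_comp (m + n) v).
Proof.
rewrite -[in LHS](addrK n m).
apply: (comp_morph (d := - n) (gen_mode_linear x n)) => i u.
exact: gen_mode_homog.
Qed.

(** The submodule it generates lives in weights at least 3, so simplicity makes it zero. *)
Lemma act_singular0 : act singular (vac V) = 0.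
Proof.
have lS := singular_span_closed.
apply: (simple_submodule0 sV vac0 (@negative_weight0 _ _ _ _ hV) lS _ _ _ singular_span0).
- apply: (affine_closed_modes hV lS) => a n v Sv.
  by apply: gen_closed lS _ a => x; apply: singular_span_gen.
- move=> n v Sv; elim: Sv n => {v} [|a u v Su IHu Sv IHv|x m u m0 Su IH] n.
  + rewrite (comp_id n act_singular_homog); case: eqP => _; last by case: lS.
    exact: singular_span0.
  + by rewrite (comp_linear n); apply: singular_span_lin.
  + by rewrite comp_gen_mode; apply: singular_span_gen.
- suff low v : singular_span v -> forall m, m < 3 -> wt_comp m v = 0.
    by move=> v /low; apply.
  elim=> {v} [|a u v Su IHu Sv IHv|x n u n0 Su IH] m m3.
  + rewrite (comp_id m act_singular_homog); case: eqP => // E.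
    by move: m3; rewrite E.
  + by rewrite (comp_linear m) IHu ?IHv // scaler0 addr0.
  + by rewrite comp_gen_mode IH ?(lin0 (gen_mode_linear x n)) //; lia.
Qed.

Lemma cosingular_kills (v : V) : homog 3 v -> act cosingular v = 0.
Proof.
have snd := mul_comb_sound gen_mode_linear level_linear gen_mode_level opc gen_mode_vac.
have lin := comb_act_linear (@gen_mode_linear) level_linear cosingular.
move: v; apply: (homog_gen_word_ind hV (Q := fun v => act cosingular v = 0)).
  split; first exact: lin0 lin.
  by move=> a u v hu hv; rewrite lin hu hv scaler0 addr0.
move=> s /(weight3_words cosingular_weight3) ks.
have -> : gen_word iota s = act [:: (1, 0%N, letters_of s)] (vac V).
  rewrite comb_act1 /intZ scale1r /=.
  by elim: s {ks} => //= x s ->.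
by rewrite snd; apply: vanishes_sound.
Qed.

End CriticalLevel.

(** * Bilinear maps and 2-cocycles on sl2 *)

Section Sl2Bilinear.
Variable K : numFieldType.
Local Notation sl2_gen := (sl2_gen K).

Lemma bracket_linear_l (b : sl2 K) : linear (fun a => bracket a b).
Proof.
move=> c a a'; apply: val_inj => /=.
by rewrite mulmxDl mulmxDr -scalemxAl -scalemxAr scalerBr opprD addrACA.
Qed.

Lemma bracket_linear_r (a : sl2 K) : linear (fun b => bracket a b).
Proof.
move=> c b b'; apply: val_inj => /=.
by rewrite mulmxDl mulmxDr -scalemxAl -scalemxAr scalerBr opprD addrACA.
Qed.

Lemma sl2_coord_linear (M : lmodType K) (u v w : M) : linear (fun a : sl2 K =>
  sl2_mx a 0 1 *: u + sl2_mx a 0 0 *: v + sl2_mx a 1 0 *: w).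
Proof.
move=> c a b; rewrite !mxE !scalerDl !scalerDr !scalerA.
by rewrite [X in X + (_ + _)]addrACA [LHS]addrACA.
Qed.

Lemma bracketC (a b : sl2 K) : bracket b a = - bracket a b.
Proof. by apply: val_inj; rewrite /= opprB. Qed.

Lemma trace_form_linear_l (b : sl2 K) : scalar (fun a => trace_form a b).
Proof.
by move=> c a a'; rewrite /trace_form mulmxDl -scalemxAl mxtraceD mxtraceZ.
Qed.

Lemma trace_form_linear_r (a : sl2 K) : scalar (fun b => trace_form a b).
Proof.
by move=> c a' b; rewrite /trace_form mulmxDr -scalemxAr mxtraceD mxtraceZ.
Qed.

Lemma sl2_gen_ind (Q : sl2 K -> Prop) :
  lin_closed Q -> (forall x, Q (sl2_gen x)) -> forall a, Q a.
Proof.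
move=> lQ Qg a; rewrite [a]sl2_decomp.
by do 2?[apply: lin_closedD => //]; apply: lin_closedZ.
Qed.

Lemma eq_bilinear (M : lmodType K) (f g : sl2 K -> sl2 K -> M) :
  (forall b, linear (fun a => f a b)) -> (forall a, linear (f a)) ->
  (forall b, linear (fun a => g a b)) -> (forall a, linear (g a)) ->
  (forall x y, f (sl2_gen x) (sl2_gen y) = g (sl2_gen x) (sl2_gen y)) ->
  f =2 g.
Proof.
move=> fl fr gl gr E a b; move: b.
apply: sl2_gen_ind => [|y].
  split=> [|c u v fu fv]; first by rewrite (lin0 (fr a)) (lin0 (gr a)).
  by rewrite fr gr fu fv.
move: a; apply: sl2_gen_ind => // ; split=> [|c u v fu fv].
  by rewrite (lin0 (fl _)) (lin0 (gl _)).
by rewrite fl gl fu fv.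
Qed.

(** Invariance under H kills all pairings of nonzero total weight; invariance under E and F relates
    the values at (H, H), (E, F) and (F, E). *)
Lemma invariant_form (M : lmodType K) (f : sl2 K -> sl2 K -> M) :
  (forall b, linear (fun a => f a b)) -> (forall a, linear (f a)) ->
  (forall a b c, f (bracket a b) c + f b (bracket a c) = 0) ->
  forall a b, f a b = trace_form a b *: f (sl2_gen E) (sl2_gen F).
Proof.
move=> fl fr inv; apply: eq_bilinear => //.
- by move=> b c u v; rewrite trace_form_linear_l scalerDl scalerA.
- by move=> a c u v; rewrite trace_form_linear_r scalerDl scalerA.
have ginv x y z : (gen_bracket x y).1%:~R *: f (sl2_gen (gen_bracket x y).2) (sl2_gen z)
    + (gen_bracket x z).1%:~R *: f (sl2_gen y) (sl2_gen (gen_bracket x z).2) = 0.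
  by rewrite -(linZ (fl _)) -(linZ (fr _)) -!bracket_gen; apply: inv.
have half (c : K) (u : M) : c != 0 -> c *: u = 0 -> u = 0.
  by move=> c0 /eqP; rewrite scaler_eq0 (negbTE c0) => /eqP.
have n2 : (2%:~R : K) != 0 by rewrite intr_eq0.
have n2' : ((-2)%:~R : K) != 0 by rewrite intr_eq0.
have HE : f (sl2_gen H) (sl2_gen E) = 0.
  by apply: (half _ _ n2); have := ginv H H E; rewrite /= scale0r add0r.
have HF : f (sl2_gen H) (sl2_gen F) = 0.
  by apply: (half _ _ n2'); have := ginv H H F; rewrite /= scale0r add0r.
have EH : f (sl2_gen E) (sl2_gen H) = 0.
  by apply: (half _ _ n2); have := ginv H E H; rewrite /= scale0r addr0.
have FH : f (sl2_gen F) (sl2_gen H) = 0.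
  by apply: (half _ _ n2'); have := ginv H F H; rewrite /= scale0r addr0.
have EE : f (sl2_gen E) (sl2_gen E) = 0.
  have := ginv H E E; rewrite /= -scalerDl; apply: half.
  by rewrite -intrD intr_eq0.
have FF : f (sl2_gen F) (sl2_gen F) = 0.
  have := ginv H F F; rewrite /= -scalerDl; apply: half.
  by rewrite -intrD intr_eq0.
have HH : f (sl2_gen H) (sl2_gen H) = 2%:~R *: f (sl2_gen E) (sl2_gen F).
  have := ginv F E H; rewrite /= scaleN1r addrC => /eqP.
  by rewrite subr_eq0 => /eqP.
have FE : f (sl2_gen F) (sl2_gen E) = f (sl2_gen E) (sl2_gen F).
  have := ginv E F H; rewrite /= scale1r HH -[-2]/(- (2 : int)) mulrNz scaleNr.
  by rewrite -scalerBr => /(half _ _ n2)/eqP; rewrite subr_eq0 => /eqP.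
by case; case; rewrite trace_form_gen ?scale0r ?scale1r.
Qed.

Definition sl2_vec (x y z : K) : sl2 K := x *: sl2_gen E + y *: sl2_gen H + z *: sl2_gen F.

Lemma sl2_vecE (a : sl2 K) : a = sl2_vec (sl2_mx a 0 1) (sl2_mx a 0 0) (sl2_mx a 1 0).
Proof. exact: sl2_decomp. Qed.

Lemma sl2_vec_inj x y z x' y' z' :
  sl2_vec x y z = sl2_vec x' y' z' -> [/\ x = x', y = y' & z = z'].
Proof.
move=> e; split; [have := congr1 (fun a => sl2_mx a 0 1) e
  | have := congr1 (fun a => sl2_mx a 0 0) e | have := congr1 (fun a => sl2_mx a 1 0) e];
  by rewrite !mxE /= ?(mulr0, mulr1, subr0, addr0, add0r).
Qed.

Lemma sl2_vecD x y z x' y' z' :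
  sl2_vec x y z + sl2_vec x' y' z' = sl2_vec (x + x') (y + y') (z + z').
Proof.
rewrite /sl2_vec !scalerDl.
by rewrite [LHS]addrACA; congr (_ + _); apply: addrACA.
Qed.

Lemma sl2_vecZ c x y z : c *: sl2_vec x y z = sl2_vec (c * x) (c * y) (c * z).
Proof. by rewrite /sl2_vec !scalerDr !scalerA. Qed.

Lemma sl2_vecN x y z : - sl2_vec x y z = sl2_vec (- x) (- y) (- z).
Proof. by rewrite /sl2_vec !opprD !scaleNr. Qed.

Lemma bracket_H_vec x y z :
  bracket (sl2_gen H) (sl2_vec x y z) = sl2_vec (2 * x) 0 (- 2 * z).
Proof.
rewrite /sl2_vec !(linD (bracket_linear_r _)) !(linZ (bracket_linear_r _)).
by rewrite !bracket_gen /= !scale0r scaler0 !scalerA [x * _]mulrC [z * _]mulrC.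
Qed.

Lemma bracket_E_vec x y z :
  bracket (sl2_gen E) (sl2_vec x y z) = sl2_vec (- 2 * y) z 0.
Proof.
rewrite /sl2_vec !(linD (bracket_linear_r _)) !(linZ (bracket_linear_r _)).
by rewrite !bracket_gen /= !scale0r scaler0 add0r addr0 scale1r !scalerA [y * _]mulrC.
Qed.

Lemma bracket_vec_E x y z :
  bracket (sl2_vec x y z) (sl2_gen E) = sl2_vec (2 * y) (- z) 0.
Proof. by rewrite bracketC bracket_E_vec sl2_vecN mulNr opprK oppr0. Qed.

Lemma bracket_vec_F x y z :
  bracket (sl2_vec x y z) (sl2_gen F) = sl2_vec 0 x (- 2 * y).
Proof.
rewrite /sl2_vec !(linD (bracket_linear_l _)) !(linZ (bracket_linear_l _)).
by rewrite !bracket_gen /= !scale0r scaler0 add0r addr0 scale1r !scalerA [y * _]mulrC.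
Qed.

(* The vanishing of H^2(sl2, sl2): a 2-cocycle with values p, q, r on
   (H, E), (H, F), (E, F) is the coboundary of an explicit linear map. *)
Lemma sl2_cocycle_trivial (p q r : sl2 K) :
  bracket (sl2_gen H) r - bracket (sl2_gen E) q - bracket p (sl2_gen F) = 0 ->
  exists psi : {linear sl2 K -> sl2 K},
  [/\ bracket (sl2_gen H) (psi (sl2_gen E)) + bracket (psi (sl2_gen H)) (sl2_gen E) + p
        = psi (bracket (sl2_gen H) (sl2_gen E)),
      bracket (sl2_gen H) (psi (sl2_gen F)) + bracket (psi (sl2_gen H)) (sl2_gen F) + q
        = psi (bracket (sl2_gen H) (sl2_gen F)) &
      bracket (sl2_gen E) (psi (sl2_gen F)) + bracket (psi (sl2_gen E)) (sl2_gen F) + r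
        = psi (bracket (sl2_gen E) (sl2_gen F))].
Proof.
rewrite [p]sl2_vecE [q]sl2_vecE [r]sl2_vecE.
move: (sl2_mx p 0 1) (sl2_mx p 0 0) (sl2_mx p 1 0) => p1 p2 p3.
move: (sl2_mx q 0 1) (sl2_mx q 0 0) (sl2_mx q 1 0) => q1 q2 q3.
move: (sl2_mx r 0 1) (sl2_mx r 0 0) (sl2_mx r 1 0) => r1 r2 r3 {p q r}.
have -> : 0 = sl2_vec 0 0 0 by rewrite /sl2_vec !scale0r !addr0.
rewrite bracket_H_vec bracket_E_vec bracket_vec_F !sl2_vecN !sl2_vecD.
move=> /sl2_vec_inj[c1 c2 c3].
(* The three coordinates of the cocycle condition give q2 = -r1, q3 = -p1 and r3 = p2. *)
have half0 (x y : K) : x = 0 -> x = 2 * y -> y = 0.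
  by move=> -> /esym/eqP; rewrite mulf_eq0 pnatr_eq0 => /eqP.
have q2E : q2 = - r1.
  by apply/eqP; rewrite -addr_eq0; apply/eqP; apply: half0 c1 _; ring.
have q3E : q3 = - p1.
  by apply/eqP; rewrite -addr_eq0 -oppr_eq0; apply/eqP; rewrite -[RHS]c2; ring.
have r3E : r3 = p2.
  by apply/esym/eqP; rewrite -subr_eq0; apply/eqP; apply: half0 c3 _; ring.
(* Solution of the linear system for psi. It is unique up to inner derivations, which are used to
   remove the E and F coordinates of psi(H) and the F coordinate of psi(F). *)
pose pE := sl2_vec (- (r2 + p1 / 2)) (p2 / 2) (p3 / 4).
pose pH := sl2_vec 0 (- (p1 / 2)) 0.
pose pF := sl2_vec (- (q1 / 4)) (- (q2 / 2)) 0.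
pose psi (a : sl2 K) : sl2 K :=
  sl2_mx a 0 1 *: pE + sl2_mx a 0 0 *: pH + sl2_mx a 1 0 *: pF.
have lpsi : linear psi by apply: sl2_coord_linear.
pose psiL : {linear sl2 K -> sl2 K} :=
  HB.pack psi (GRing.isLinear.Build K _ _ *:%R psi lpsi).
have psiE : psiL (sl2_gen E) = pE.
  by rewrite -[LHS]/(psi _) /psi !mxE /= !scale0r scale1r !addr0.
have psiH : psiL (sl2_gen H) = pH.
  by rewrite -[LHS]/(psi _) /psi !mxE /= subr0 !subr0 !scale0r scale1r add0r addr0.
have psiF : psiL (sl2_gen F) = pF.
  by rewrite -[LHS]/(psi _) /psi !mxE /= !scale0r scale1r !add0r.
have psiZ c a : psiL (c *: a) = c *: psiL a by exact: (linZ lpsi).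
have congr3 x y z x' y' z' : x = x' -> y = y' -> z = z' ->
    sl2_vec x y z = sl2_vec x' y' z' by move=> -> -> ->.
clearbody psiL; exists psiL; rewrite !bracket_gen /= !psiZ !psiE !psiH !psiF /pE /pH /pF.
rewrite !bracket_H_vec !bracket_E_vec !bracket_vec_E !bracket_vec_F !sl2_vecZ !sl2_vecD.
rewrite q2E q3E r3E; split; apply: congr3; by field.
Qed.

End Sl2Bilinear.

(** * Deformed affine relations *)

Section Deformation.
Variables (K : numFieldType) (k : K) (V : vertexAlgebra K) (iota : {linear sl2 K -> V}).
Hypotheses (hV : affine_quotient k iota) (vac0 : vac V <> 0) (k0 : k != 0).
Variables (Y1 : V -> int -> V -> V) (hY : first_order_deformation Y1).

Local Notation W := (dual_va hY).

Let va := va_axioms V.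

Lemma iota_mode0 a b : mode (iota a) 0 (iota b) = iota (bracket a b).
Proof.
have [_ _ hc] := aq_module hV.
have := hc a b 0 (-1) (vac V); rewrite [affine_mode iota a 0 (vac V)](aq_vac hV) //.
rewrite [affine_mode iota b _ 0]mode0r subr0 add0r (affine_mode_vac iota) /= scale0r addr0.
by rewrite (affine_mode_vac iota).
Qed.

Lemma iota_mode1 a b : mode (iota a) 1 (iota b) = (k * trace_form a b) *: vac V.
Proof.
have [_ _ hc] := aq_module hV.
have := hc a b 1 (-1) (vac V); rewrite [affine_mode iota a 1 (vac V)](aq_vac hV) //.
rewrite [affine_mode iota b _ 0]mode0r subr0 (affine_mode_vac iota) (aq_vac hV) // add0r.
by rewrite eqxx mul1r mulrC.
Qed.

(** The modes x(1) recover k <x, a> from [iota a]; the trace form is non-degenerate and k is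
    nonzero. *)
Lemma iota_inj a : iota a = 0 -> a = 0.
Proof.
move=> a0.
have tf x : trace_form (sl2_gen K x) a = 0.
  have := iota_mode1 (sl2_gen K x) a; rewrite a0 mode0r => /esym/eqP.
  rewrite scaler_eq0 mulf_eq0 (negbTE k0) /=.
  by case/orP => /eqP.
have tv g x y z : trace_form (sl2_gen K g) (sl2_vec x y z) =
    match g with E => z | H => 2 * y | F => x end.
  have lin : linear (fun b => trace_form (sl2_gen K g) b : K^o).
    exact: trace_form_linear_r.
  have linZ' c b : trace_form (sl2_gen K g) (c *: b) = c * trace_form (sl2_gen K g) b.
    exact: linZ lin c b.
  rewrite /sl2_vec !(linD lin) !linZ' !trace_form_gen.
  by case: g {lin linZ'}; rewrite /= ?(mulr0, mulr1, addr0, add0r) // mulrC.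
move: tf; rewrite [a]sl2_vecE => tf.
have := tf E; have := tf F; have := tf H; rewrite !tv => /eqP.
rewrite mulf_eq0 pnatr_eq0 => /eqP -> -> ->.
by rewrite /sl2_vec !scale0r !addr0.
Qed.

Lemma dual_negative_weight n (w : W) : n < 0 -> homog n w -> w = 0.
Proof.
move=> n0 [h1 h2]; rewrite [w]surjective_pairing.
by rewrite (negative_weight0 hV n0 h1) (negative_weight0 hV n0 h2).
Qed.

Lemma dual_weight0 (w : W) : homog 0 w ->
  exists x y, w = (x *: vac V, y *: vac V).
Proof.
move=> [/(weight0_vac hV)[x e1] /(weight0_vac hV)[y e2]]; exists x, y.
by rewrite -e1 -e2 -surjective_pairing.
Qed.

Lemma dual_weight0_mode x y n (w : W) :
  mode ((x *: vac V, y *: vac V) : W) n w =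
  if n == -1 then ((x *: w.1, x *: w.2 + y *: w.1) : W) else 0.
Proof.
rewrite [LHS]/mode /= /dual_mode /= !modeZl !(va_vacuum va).
rewrite (linZ (def_linear_l hY _ _)) (def_vac_l hY) scaler0 addr0.
by case: ifP => _; rewrite ?scaler0 ?addr0.
Qed.

Lemma dual_mode_weight0 (u w : W) n : 0 <= n -> homog 0 w -> mode u n w = 0.
Proof.
move=> n0 /dual_weight0[x [y ->]].
rewrite [LHS]/mode /= /dual_mode /= !modeZr (linZ (def_linear_r hY _ _)).
by rewrite !(va_creation va) // (def_vac_r hY) !scaler0 !addr0.
Qed.

Lemma dual_weight1_mode (u w : W) (i : nat) : homog 1 u -> homog 1 w -> (1 < i)%N ->
  mode u i%:Z w = 0.
Proof.
move=> hu hw i1; apply: dual_negative_weight (va_mode_wt (va_axioms W) _ hu hw).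
by lia.
Qed.

Lemma dual_weight1_commutator (a b : W) : homog 1 a -> homog 1 b ->
  forall (m n : int) (w : W),
  mode a m (mode b n w) - mode b n (mode a m w) =
  mode (mode a 0 b) (m + n) w + m%:~R *: mode (mode a 1 b) (m + n - 1) w.
Proof.
move=> ha hb m n w.
rewrite (@commutator_formula _ W a b 2) => [|i i2]; last exact: dual_weight1_mode.
by rewrite !big_ord_recl big_ord0 /= gbinom_n0 gbinom_n1 scale1r !addr0.
Qed.

(** The correction terms of skew symmetry are (a_i b)_(-1-i) 1 with i >= 1. They vanish, as a_1 b is
    a dual-number multiple of the vacuum, whose only mode is -1, and a_i b = 0 for i > 1 by
    weight. *)
Lemma dual_weight1_skew (a b : W) : homog 1 a -> homog 1 b ->
  mode b 0 a = - mode a 0 b.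
Proof.
move=> ha hb; apply/eqP; rewrite -eqr_oppLR; apply/eqP.
have := @skew_symmetry _ W a 0 b; rewrite expr0z scale1r => ->.
rewrite (@fsbig_nat_trunc _ _ _ 1) => [|[|[|i]] // _].
- by rewrite big_ord1 gbinom_n0 scale1r; apply: (va_creation0 (va_axioms W)).
- have /dual_weight0[x [y ->]] : homog 0 (mode a 1 b).
    exact: (va_mode_wt (va_axioms W) 1 ha hb).
  by rewrite dual_weight0_mode scaler0.
- by rewrite dual_weight1_mode // mode0l scaler0.
Qed.

(* iota corrected to first order so that the Lie bracket of V_1 is not deformed *)
Lemma gauge_exists : exists psi : {linear sl2 K -> sl2 K},
  forall a b, mode ((iota a, iota (psi a)) : W) 0 ((iota b, iota (psi b)) : W)
    = (iota (bracket a b), iota (psi (bracket a b))).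
Proof.
pose i0 a : W := (iota a, 0).
have h0 : homog 1 (0 : V) := grading_zero (va_grading va) 1.
have hi0 a : homog 1 (i0 a) by split; [apply: (iota_homog hV) | ].
have ex a b : exists c, Y1 (iota a) 0 (iota b) = iota c.
  apply: (weight1_iota hV).
  exact: (def_wt hY 0 (iota_homog hV a) (iota_homog hV b)).
have [p pE] := ex (sl2_gen K H) (sl2_gen K E).
have [q qE] := ex (sl2_gen K H) (sl2_gen K F).
have [r rE] := ex (sl2_gen K E) (sl2_gen K F).
have i0E a b : mode (i0 a) 0 (i0 b) = (iota (bracket a b), Y1 (iota a) 0 (iota b)).
  rewrite [LHS]/mode /= /dual_mode /= iota_mode0 mode0r mode0l.
  by rewrite addr0 add0r.
have Yskew a b : Y1 (iota b) 0 (iota a) = - Y1 (iota a) 0 (iota b).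
  have := dual_weight1_skew (hi0 a) (hi0 b); rewrite !i0E.
  by move=> /(congr1 (fun w : V * V => w.2)).
have Yself a : Y1 (iota a) 0 (iota a) = 0.
  have /eqP := Yskew a a; rewrite -addr_eq0 -mulr2n -scaler_nat scaler_eq0 pnatr_eq0.
  by move=> /eqP.
have YZ c a b : Y1 (iota a) 0 (c *: iota b) = c *: Y1 (iota a) 0 (iota b).
  exact: (linZ (def_linear_r hY _ _)).
have YZl c a b : Y1 (c *: iota a) 0 (iota b) = c *: Y1 (iota a) 0 (iota b).
  exact: (linZ (def_linear_l hY _ _)).
(* The cocycle condition is the t-coefficient of the commutator of the zero modes of H and E,
   applied to F. *)
have coc : bracket (sl2_gen K H) r - bracket (sl2_gen K E) q
    - bracket p (sl2_gen K F) = 0.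
  apply: iota_inj.
  have := dual_weight1_commutator (hi0 (sl2_gen K H)) (hi0 (sl2_gen K E)) 0 0
    (i0 (sl2_gen K F)).
  rewrite scale0r addr0 !i0E => /(congr1 (fun w : V * V => w.2)).
  rewrite /mode /= /dual_mode /=.
  rewrite pE qE rE !bracket_gen /= !linearZ /= YZl !YZ Yself !rE.
  rewrite !mode0l !addr0 mode0r add0r !iota_mode0 !scaler0 addr0.
  rewrite -[-2]/(- (2 : int)) mulrNz scaleNr opprD opprK => e.
  rewrite !linearB /=; apply/eqP; rewrite subr_eq0; apply/eqP.
  by apply: (addIr (2%:~R *: iota r)); rewrite -e addrA.
have [psi [psiHE psiHF psiEF]] := sl2_cocycle_trivial coc.
exists psi.
pose j a : W := (iota a, iota (psi a)).
have hj a : homog 1 (j a) by split; apply: (iota_homog hV).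
have lj : linear j by move=> c a b; rewrite /j !linearP.
apply: (eq_bilinear (f := fun a b => mode (j a) 0 (j b)) (g := fun a b => j (bracket a b))).
- by move=> b c u v; rewrite lj modeDl modeZl.
- by move=> a c u v; rewrite lj modeDr modeZr.
- by move=> b c u v; rewrite (bracket_linear_l b) lj.
- by move=> a c u v; rewrite (bracket_linear_r a) lj.
have jE a b c : Y1 (iota a) 0 (iota b) = iota c ->
    bracket a (psi b) + bracket (psi a) b + c = psi (bracket a b) ->
    mode (j a) 0 (j b) = j (bracket a b).
  move=> Yc e; rewrite [RHS]/j -e [LHS]/mode /= /dual_mode /= !iota_mode0 Yc.
  by rewrite !linearD.
have jC a b : mode (j a) 0 (j b) = j (bracket a b) ->
    mode (j b) 0 (j a) = j (bracket b a).
  by move=> jab; rewrite dual_weight1_skew // jab (bracketC a b) (linN lj).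
have jj a : mode (j a) 0 (j a) = j (bracket a a).
  have half (M : lmodType K) (u : M) : u = - u -> u = 0.
    move=> /eqP; rewrite -addr_eq0 -mulr2n -scaler_nat scaler_eq0 pnatr_eq0.
    by move=> /eqP.
  rewrite (half _ _ (dual_weight1_skew (hj a) (hj a))).
  by rewrite (half _ _ (bracketC a a)) (lin0 lj).
by case; case => //; do ?[by apply: jE; eassumption | by apply: jC; apply: jE; eassumption].
Qed.

(** Multiplication by the dual number k + t k'. *)
Definition dual_level (k' : K) (w : V * V) : V * V := (k *: w.1, k *: w.2 + k' *: w.1).

(** After the correction, (a, b) |-> a_1 b is an invariant form with values in the dual-number
    multiples of the vacuum, hence a multiple of the trace form. Its value at (E, F) is the deformed
    level. *)
Lemma dual_affine_relations : exists (psi : {linear sl2 K -> sl2 K}) (k' : K),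
  let j a : W := (iota a, iota (psi a)) in
  forall a b m n (w : W),
    mode (j a) m (mode (j b) n w) - mode (j b) n (mode (j a) m w) =
    mode (j (bracket a b)) (m + n) w
    + ((if m + n == 0 then m%:~R * trace_form a b else 0) *: dual_level k' w : W).
Proof.
have [psi hpsi] := gauge_exists.
pose j a : W := (iota a, iota (psi a)).
have hj a : homog 1 (j a) by split; apply: (iota_homog hV).
have lj : linear j by move=> c a b; rewrite /j !linearP.
have hp a b : mode (j a) 0 (j b) = j (bracket a b) by exact: hpsi.
pose f a b := mode (j a) 1 (j b).
have fE a b : f a b = trace_form a b *: f (sl2_gen K E) (sl2_gen K F).
  apply: invariant_form => {a b}.
  - by move=> b c u v; rewrite /f lj modeDl modeZl.
  - by move=> a c u v; rewrite /f lj modeDr modeZr.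
  (* Invariance: commute a_0 with b_1 on c, where a_0 kills the weight 0 vector b_1 c. *)
  move=> a b c; have := dual_weight1_commutator (hj a) (hj b) 0 1 (j c).
  rewrite scale0r addr0 add0r !hp (dual_mode_weight0 (j a)) //; last first.
    exact: (va_mode_wt (va_axioms W) 1 (hj b) (hj c)).
  by rewrite sub0r /f => <-; rewrite addNr.
have [x [y zE]] : exists x y,
    f (sl2_gen K E) (sl2_gen K F) = (x *: vac V, y *: vac V) :> W.
  exact: dual_weight0 (va_mode_wt (va_axioms W) 1 (hj _) (hj _)).
have xk : x = k.
  have := congr1 (fun w : V * V => w.1) zE.
  rewrite /= iota_mode1 trace_form_gen mulr1 => /eqP.
  rewrite -subr_eq0 -scalerBl scaler_eq0 subr_eq0.
  by case/orP => /eqP.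
exists psi, y => /= a b m n w.
rewrite (dual_weight1_commutator (hj a) (hj b)) -[mode (j a) 1 (j b)]/(f a b) fE zE xk.
rewrite hp modeZl dual_weight0_mode -(inj_eq (addIr 1)) subrK addNr.
by case: ifP => _; rewrite ?scaler0 ?scale0r // scalerA.
Qed.

End Deformation.

(** * Rigidity of the level *)

Section Rigidity.
Variables (K : numFieldType) (V : vertexAlgebra K) (iota : {linear sl2 K -> V}).
Hypothesis hV : affine_quotient (- (4 / 3)) iota.
Hypotheses (sV : simple_va V) (vac0 : vac V <> 0).
Variables (Y1 : V -> int -> V -> V) (hY : first_order_deformation Y1).
Variables (psi : {linear sl2 K -> sl2 K}) (k' : K).

Local Notation k := (- (4 / 3) : K).
Local Notation W := (dual_va hY).
Local Notation C := (dual_level k k').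
Let j a : W := (iota a, iota (psi a)).

Hypothesis relations : forall a b m n (w : W),
    mode (j a) m (mode (j b) n w) - mode (j b) n (mode (j a) m w) =
    mode (j (bracket a b)) (m + n) w
    + ((if m + n == 0 then m%:~R * trace_form a b else 0) *: C w : W).

Let op x n (w : W) : W := mode (j (sl2_gen K x)) n w.

Lemma level_not_deformed : k' = 0.
Proof.
have opl x n : linear (op x n) by apply: mode_lin_r.
have Cl : linear (C : W -> W).
  move=> c u v; rewrite /dual_level; congr pair; rewrite /= !scalerDr !scalerA.
    by rewrite mulrC.
  by rewrite [c * k]mulrC [c * k']mulrC addrACA.
have opC x n (w : W) : op x n (C w) = C (op x n w).
  rewrite /op /dual_level [LHS]/mode [RHS]/= /dual_mode /=; congr pair.
    by rewrite /= modeZr.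
  rewrite /= !modeDr !modeZr (linZ (def_linear_r hY _ _)) !scalerDr.
  by rewrite -!addrA; congr (_ + _); rewrite [LHS]addrC -addrA.
have lj : linear j by move=> c a b; rewrite /j !linearP.
have opc x y m n (w : W) : op x m (op y n w) - op y n (op x m w) =
    (gen_bracket x y).1%:~R *: op (gen_bracket x y).2 (m + n) w
    + (if m + n == 0 then (m * gen_form x y)%:~R else 0) *: (C w : W).
  rewrite /op relations bracket_gen (linZ lj) modeZl trace_form_gen.
  by rewrite intrM.
have opv x n : 0 <= n -> op x n (vac W) = 0 by apply: (va_creation (va_axioms W)).
pose act := comb_act op (C : W -> W).
pose act0 := comb_act (gen_mode iota) (fun v : V => k *: v).
(* This is (k + t k')^i; the truncated [i.-1] is harmless at i = 0, where the factor i vanishes. *)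
have iterC i (w : W) : iter i C w =
    (k ^+ i *: w.1, k ^+ i *: w.2 + (i%:R * k ^+ i.-1 * k') *: w.1).
  elim: i => [|i IH]; first by rewrite /= !mul0r !scale1r scale0r addr0 -surjective_pairing.
  rewrite iterS IH /dual_level; congr pair; rewrite /= ?scalerDr !scalerA -?exprS //.
  rewrite -addrA -scalerDl; congr (_ + _ *: _).
  case: i {IH} => [|i] /=; first by rewrite expr0; ring.
  by rewrite (exprS _ i) -[i.+2%:R]natr1; ring.
have act_fst L (w : W) : (act L w).1 = act0 L w.1.
  rewrite /act /comb_act (big_morph (fun w : V * V => w.1) (fun _ _ => erefl) erefl).
  apply: eq_bigr => t _ /=; congr (_ *: _).
  rewrite iterC; transitivity (k ^+ t.1.2 *: op_word (gen_mode iota) t.2 w.1).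
    by congr (_ *: _); elim: t.2 => //= l s <-.
  elim: t.1.2 => [|i IH]; first by rewrite scale1r.
  by rewrite exprS -scalerA IH.
(* On t V the contributions of [psi], [Y1] and [k'] are divisible by t^2, so the action is that on
   V. *)
have act_eps L (v : V) : act L ((0, v) : W) = (0, act0 L v).
  have act00 : act0 L 0 = 0.
    by apply: lin0; apply: comb_act_linear; [exact: gen_mode_linear|exact: level_linear].
  rewrite [LHS]surjective_pairing act_fst act00; congr pair.
  rewrite /act /comb_act (big_morph (fun w : V * V => w.2) (fun _ _ => erefl) erefl).
  apply: eq_bigr => t _ /=; congr (_ *: _).
  have -> : op_word op t.2 ((0, v) : W) = (0, op_word (gen_mode iota) t.2 v).
    elim: t.2 => //= l s ->.
    by rewrite [LHS]/mode /= /dual_mode /= !mode0r (def0r hY) !addr0.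
  rewrite iterC /= scaler0 addr0.
  elim: t.1.2 => [|i IH]; first by rewrite scale1r.
  by rewrite exprS -scalerA IH.
have s1 : (act singular (vac W)).1 = 0.
  by rewrite act_fst; exact: (act_singular0 hV sV vac0).
have s2 : homog 3 (act singular (vac W)).2.
  have [] // : homog 3 (act singular (vac W)).
  apply: comb_act_homog singular_weight.
  - move=> x n m w hw.
    have hj : homog 1 (j (sl2_gen K x)) by split; apply: (iota_homog hV).
    by have := va_mode_wt (va_axioms W) n hj hw; congr homog; ring.
  - move=> m w [h1 h2]; split; first exact: homogZ.
    by apply: homogD; apply: homogZ.
  - exact: (va_vac_wt (va_axioms W)).
(* P 1 vanishes modulo t, so it lies in t V_3, where P' acts as on V_3, that is, by 0. *)
have : act cosingular (act singular (vac W)) = 0.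
  rewrite [act singular _]surjective_pairing s1 act_eps.
  suff -> : act0 cosingular (act singular (vac W)).2 = 0 by [].
  by apply: (cosingular_kills hV); exact: s2.
rewrite /act (mul_comb_sound opl Cl opC opc opv) -/act.
have /andP[/allP hL] := cosingular_singular.
set L := mul_comb _ _ in hL *; set d := foldr _ _ _ => d0 L0.
clearbody L.
(* Both sides are 9 times the t-coefficient of p(k + t k') 1. *)
have dE : intZ K d *: (k' *: vac V) = 9%:R *: (act L (vac W)).2.
  rewrite /act /comb_act (big_morph (fun w : V * V => w.2) (fun _ _ => erefl) erefl).
  rewrite /d {d d0 L0} scaler_sumr; elim: L hL => [|t L IH] hL.
    by rewrite big_nil /= /intZ scale0r.
  rewrite big_cons /= intZD scalerDl IH => [|u uL]; last by rewrite hL // inE uL orbT.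
  congr (_ + _); have /andP[t3 /eqP ->] := hL t (mem_head _ _).
  rewrite iterC /= scaler0 add0r !scalerA; congr (_ *: _).
  rewrite /deriv9 !intZM !intZX intZ_oppnat !intZ_nat.
  by case: t.1.2 t3 => [|[|[|[|//]]]] _ /=; field.
apply/eqP; move: dE; rewrite L0 scaler0 scalerA => /eqP.
rewrite scaler_eq0 mulf_eq0 => /orP[/orP[|//]|/eqP //].
rewrite /intZ intr_eq0 => /eqP dz.
by move: d0; rewrite -[d]int_of_ZK dz.
Qed.

End Rigidity.

(** * Triviality *)

Section Triviality.
Variables (K : numFieldType) (U V : vertexAlgebra K).
Variables (iota : {linear sl2 K -> U}) (pi : {linear U -> V}).
Hypotheses (hU : universal_affine (- (4 / 3)) iota) (hpi : simple_quotient pi).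
Variables (Y1 : V -> int -> V -> V) (hY : first_order_deformation Y1).

Local Notation k := (- (4 / 3) : K).
Local Notation W := (dual_va hY).
Local Notation iotaV := (quotient_iota iota pi).

Let qU := universal_affine_quotient hU.
Let qV := quotient_affine_quotient qU hpi.
Let vac0 := quotient_vac_neq0 hpi.

Lemma deformed_lift : exists (psi : {linear sl2 K -> sl2 K}) (f : {linear U -> W}),
  f (vac U) = vac W /\
  forall a n u, f (affine_mode iota a n u) = mode ((iotaV a, iotaV (psi a)) : W) n (f u).
Proof.
have k0 : k != 0 by rewrite oppr_eq0 mulf_neq0 ?invr_eq0 ?pnatr_eq0.
have [psi [k' rel]] := dual_affine_relations qV vac0 k0 hY; exists psi.
have k'0 := level_not_deformed qV (quotient_simple hpi) vac0 rel.
pose j a : W := (iotaV a, iotaV (psi a)).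
have lj : linear j by move=> c a b; rewrite /j !linearP.
apply: (ua_universal hU (M := W) (act := fun a n w => mode (j a) n w)).
- split.
  + by move=> a n; apply: mode_lin_r.
  + by move=> n w c a b; rewrite lj modeDl modeZl.
  + move=> a b m n w; rewrite rel k'0; congr (_ + _).
    have -> : dual_level k 0 w = k *: (w : W).
      by rewrite /dual_level; congr pair; rewrite /= scale0r addr0.
    by rewrite scalerA; case: ifP => _; rewrite ?mul0r.
- by move=> a n n0; apply: (va_creation (va_axioms W)).
Qed.

Lemma triviality : trivial_deformation Y1.
Proof.
have [psi [f [fvac fmode]]] := deformed_lift.
pose j a : W := (iotaV a, iotaV (psi a)).
have fst_f u : (f u).1 = pi u.
  move: u; apply: (affine_word_ind qU (Q := fun u => (f u).1 = pi u)).
    split; first by rewrite !linear0.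
    by move=> a u v fu fv; rewrite !linearP /= fu fv.
  elim=> [|[a n] s IH] /=; first by rewrite fvac (quotient_vac hpi).
  by rewrite fmode /= IH -(quotient_affine_mode iota hpi).
have f_homog n u : homog n u -> homog n (f u).
  move: u; apply: (homog_affine_word_ind qU (Q := fun u => homog n (f u))).
    split; first by rewrite linear0; apply: (grading_zero (va_grading (va_axioms W))).
    by move=> a u v; rewrite linearP; apply: (grading_lin (va_grading (va_axioms W))).
  move=> s <-; elim: s => [|[a i] s IH] /=.
    by rewrite big_nil fvac; apply: (va_vac_wt (va_axioms W)).
  rewrite big_cons fmode /=.
  have hj : homog 1 (j a) by split; apply: (iota_homog qV).
  have := va_mode_wt (va_axioms W) (- (i.+1)%:Z) hj IH; congr homog.
have lf : linear f by apply: linearP.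
have f_comp n u : wt_comp n (f u) = f (wt_comp n u).
  exact: (comp_morph0 lf f_homog).
have pi_comp n u : wt_comp n (pi u) = pi (wt_comp n u).
  apply: comp_morph0; first exact: linearP.
  by case: hpi => -[_ _ hw] _ _; apply: hw.
have comp_snd n (v : V) : wt_comp n ((0, v) : W) = (0, wt_comp n v).
  apply: (comp_morph0 (f := fun v : V => (0, v) : W)).
    by move=> c u w; congr pair; rewrite /= scaler0 addr0.
  move=> m w hw; split=> //.
  exact: (grading_zero (va_grading (va_axioms V))).
have ker u : pi u = 0 -> f u = 0.
  (* The image under f of the kernel of [pi], viewed in V through v |-> t v. *)
  move=> pu; pose I v := exists2 u, pi u = 0 & f u = ((0, v) : W).
  have fu2 : I (f u).2.
    by exists u => //; rewrite -[in RHS]pu -fst_f -surjective_pairing.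
  suff I0 : forall v, I v -> v = 0.
    by rewrite [f u]surjective_pairing fst_f pu (I0 _ fu2).
  have lI : lin_closed I.
    split; first by exists 0; rewrite linear0.
    move=> a v w [u1 p1 f1] [u2 p2 f2]; exists (a *: u1 + u2).
      by rewrite linearP p1 p2 scaler0 addr0.
    by rewrite linearP f1 f2; congr pair; rewrite /= scaler0 addr0.
  apply: (simple_submodule0 (quotient_simple hpi) vac0 (@negative_weight0 _ _ _ _ qV) lI).
  - apply: (affine_closed_modes qV lI) => a n w [u1 p1 f1].
    exists (affine_mode iota a n u1).
      by rewrite -(quotient_affine_mode iota hpi) p1 /affine_mode mode0r.
    rewrite fmode f1 [LHS]/mode /= /dual_mode /= !mode0r (def0r hY) !addr0.
    by [].
  - move=> n w [u1 p1 f1]; exists (wt_comp n u1).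
      by rewrite -pi_comp p1 (lin0 (@comp_linear _ V n)).
    by rewrite -f_comp f1 comp_snd.
  - move=> w [u1 p1 f1].
    (* The weight 0 part of V^k is spanned by the vacuum, which [pi] does not kill. *)
    have u10 : wt_comp 0 u1 = 0.
      have [c cE] := weight0_vac qU (comp_homog 0 u1).
      have /eqP : c *: vac V = 0.
        by rewrite -(quotient_vac hpi) -linearZ -cE -pi_comp p1 (lin0 (@comp_linear _ V 0)).
      by rewrite scaler_eq0 cE => /orP[/eqP ->|/eqP/vac0 //]; rewrite scale0r.
    have := comp_snd 0 w; rewrite -f1 f_comp u10 linear0.
    by move=> /(congr1 (fun w : V * V => w.2)).
(* An arbitrary preimage; by [ker] the value of f does not depend on it. *)
pose r v := projT1 (cid (quotient_surj hpi v)).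
have rE v : pi (r v) = v by rewrite /r; case: cid.
pose s v : W := f (r v).
have sE u : s (pi u) = f u.
  by apply/eqP; rewrite -subr_eq0 -linearB ker ?linearB ?rE ?subrr.
have ls : linear s.
  move=> a u v; rewrite -linearP -[LHS]sE /s.
  by rewrite -[RHS]sE linearP !rE.
have s1 v : (s v).1 = v by rewrite /s fst_f rE.
have svac : s (vac V) = vac W by rewrite -(quotient_vac hpi) sE.
have s_affine a n v : s (affine_mode iotaV a n v) = mode (j a) n (s v).
  by rewrite -[in LHS](rE v) (quotient_affine_mode iota hpi) sE fmode.
(* So far s respects only the modes of sl2. On a word a(-n) w, associativity gives sums of finite
   support, which the linear map s preserves. *)
have s_mode u n v : s (mode u n v) = mode (s u) n (s v).
  move: u n v; apply: (affine_word_ind qV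
    (Q := fun u => forall n v, s (mode u n v) = mode (s u) n (s v))).
    split; first by move=> n v; rewrite mode0l (lin0 ls) mode0l.
    by move=> c u w hu hw n v; rewrite modeDl modeZl !ls hu hw modeDl modeZl.
  elim=> [|[a i] w IH] n v.
    rewrite svac (va_vacuum (va_axioms V)) (va_vacuum (va_axioms W)).
    by case: ifP; rewrite ?(lin0 ls).
  rewrite -[affine_word _ (_ :: _)]/(affine_mode iotaV a (- (i.+1)%:Z) (affine_word iotaV w)).
  have trunc_up_V (u1 u2 u3 : V) : trunc_up (fun p q => mode u1 p (mode u2 q u3)).
    exact: (trunc_up_comp (fun p => mode0r u1 p) (va_trunc (va_axioms V) u2 u3)).
  have trunc_down_V (u1 u2 u3 : V) : trunc_down (fun p q => mode u2 q (mode u1 p u3)).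
    exact: (trunc_down_comp (fun p => mode0r u2 p) (va_trunc (va_axioms V) u1 u3)).
  rewrite [in RHS]s_affine /affine_mode !associativity_formula (linB ls).
  congr (_ - _).
  - rewrite (fsbig_nat_lin ls (truncatedZ _ (trunc_up_V _ _ _ _ _))).
    apply: eq_fsbig_nat => m.
    by rewrite (linZ ls) -[mode (iotaV a) _ _]/(affine_mode iotaV a _ _) s_affine IH.
  - have tr := trunc_down_V (iotaV a) (affine_word iotaV w) v 0 (- (i.+1)%:Z + n).
    rewrite (fsbig_nat_lin ls); last first.
      by apply: truncatedZ; case: tr => N hN; exists N => m /hN; rewrite add0r.
    apply: eq_fsbig_nat => m.
    by rewrite (linZ ls) IH -[mode (iotaV a) _ _]/(affine_mode iotaV a _ _) s_affine.
pose phi v := - (s v).2.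
have lphi : linear phi.
  by move=> a u v; rewrite /phi ls /= opprD scalerN.
pose phiL : {linear V -> V} := HB.pack phi (GRing.isLinear.Build K V V *:%R phi lphi).
exists phiL; split.
- move=> n v hv; rewrite -[phiL v]/(phi v) /phi -scaleN1r; apply: homogZ.
  have [] // : homog n (s v).
  have := comp_id n hv; rewrite eqxx => E.
  by rewrite -E -{1}(rE v) pi_comp sE -f_comp; apply: comp_homog.
- by rewrite -[LHS]/(phi _) /phi svac oppr0.
(* The t-coefficient of s(u_n v) = s(u)_n s(v), solved for [Y1]; the t-coefficient of s is -phi. *)
- move=> u v n; rewrite -![phiL _]/(phi _) /phi s_mode opprK.
  rewrite [mode (s u) n (s v)]/mode /= /dual_mode /= !s1 modeNl modeNr.
  move: (mode u n (s v).2) (mode (s u).2 n v) (Y1 u n v) => A B D.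
  by rewrite [A + B]addrC -[B + A + D]addrA (addKr B) addrAC subrr add0r.
Qed.

End Triviality.

Theorem theorem5p1 (R : realType) (V : vertexAlgebra R[i])
    (hV : is_simple_affine_sl2 (- (4 / 3)) V)
    (Y1 : V -> int -> V -> V) (hY1 : first_order_deformation Y1) :
  trivial_deformation Y1.
Proof. by have [U [iota [pi [hU hpi]]]] := hV; exact: (triviality hU hpi hY1). Qed.
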